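(* Let $q\in(0,1)$ and $m,n\in\mathbb N$. The inner product $(\,\cdot\,,\,\cdot\,)_F$ in $\mathbb C[\mathrm{Mat}_{m,n}]_q$ is $U_q\mathfrak s(\mathfrak u(n)\oplus\mathfrak u(m))$-invariant, i.e. $$(\xi(P),Q)_F=(P,\xi^*(Q))_F$$ for all $P,Q\in\mathbb C[\mathrm{Mat}_{m,n}]_q$ and all $\xi\in U_q\mathfrak s(\mathfrak{gl}(n)\oplus\mathfrak{gl}(m))$.
   Context: Ground field $\mathbb C$, $q\in(0,1)$. An inner product is a positive definite Hermitian form, linear in the first argument. $\mathbb C[\mathrm{Mat}_{m,n}]_q$ is the unital algebra with generators $z_a^\alpha$, $a=1,\dots,n$, $\alpha=1,\dots,m$, and relations: $z_a^\alpha z_b^\beta=q z_b^\beta z_a^\alpha$ if ($a=b$, $\alpha<\beta$) or ($a<b$, $\alpha=\beta$); $z_a^\alpha z_b^\beta=z_b^\beta z_a^\alpha$ if $a<b$, $\alpha>\beta$; $z_a^\alpha z_b^\beta=z_b^\beta z_a^\alpha+(q-q^{-1})z_a^\beta z_b^\alpha$ if $a<b$, $\alpha<\beta$. *$q$-partial derivatives.* $\Lambda^1(\mathrm{Mat}_{m,n})_q$ is the $\mathbb C[\mathrm{Mat}_{m,n}]_q$-bimodule with generators $dz_a^\alpha$ and relations $z_b^\beta dz_a^\alpha=\sum_{\alpha',\beta'=1}^m\sum_{a',b'=1}^nR_{\beta\alpha}^{\beta'\alpha'}R_{ba}^{b'a'}dz_{a'}^{\alpha'}\cdot z_{b'}^{\beta'}$,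 where $R_{ba}^{b'a'}=q^{-1}$ if $a=b=a'=b'$; $1$ if $a\ne b$, $a=a'$, $b=b'$; $q^{-1}-q$ if $a<b$, $a=b'$, $b=a'$; $0$ otherwise. It is a free left module with generators $dz_a^\alpha$; $d:\mathbb C[\mathrm{Mat}_{m,n}]_q\to\Lambda^1(\mathrm{Mat}_{m,n})_q$ is the linear map with $d(z_a^\alpha)=dz_a^\alpha$ satisfying the Leibniz rule, and $\frac{\partial f}{\partial z_a^\alpha}$ is defined by $df=\sum_{a,\alpha}\frac{\partial f}{\partial z_a^\alpha}dz_a^\alpha$. *The inner product.* $(\cdot,\cdot)_F$ is the unique inner product in $\mathbb C[\mathrm{Mat}_{m,n}]_q$ such that $(1,1)_F=1$ and $\big(\frac{\partial P}{\partial z_a^\alpha},Q\big)_F=(P,Q\cdot z_a^\alpha)_F$ for all $a,\alpha,P,Q$. *Quantum symmetry.* $U_q\mathfrak{sl}(k)$ is the Drinfeld–Jimbo Hopf algebra with generators $E_i,F_i,K_i^{\pm1}$, $i=1,\dots,k-1$, with $K_iE_j=q^{a_{ij}}E_jK_i$, $K_iF_j=q^{-a_{ij}}F_jK_i$, $K_iK_j=K_jK_i$, $E_iF_j-F_jE_i=\delta_{ij}(K_i-K_i^{-1})/(q-q^{-1})$, the quantum Serre relations ($(a_{ij})$ the Cartan matrix of $\mathfrak{sl}(k)$), $\Delta(E_i)=E_i\otimes1+K_i\otimes E_i$, $\Delta(F_i)=F_i\otimes K_i^{-1}+1\otimes F_i$, $\Delta(K_i)=K_i\otimes K_i$, $S(E_i)=-K_i^{-1}E_i$,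 $S(F_i)=-F_iK_i$, $S(K_i)=K_i^{-1}$, $\varepsilon(E_i)=\varepsilon(F_i)=0$, $\varepsilon(K_i)=1$. Put $U_q(\mathfrak{sl}(n)\oplus\mathfrak{sl}(m))=U_q\mathfrak{sl}(n)\otimes U_q\mathfrak{sl}(m)$; $U_q\mathfrak s(\mathfrak{gl}(n)\oplus\mathfrak{gl}(m))$ is obtained from it by adding an invertible generator $K_0$ commuting with the other generators, with $\Delta(K_0)=K_0\otimes K_0$, $S(K_0)=K_0^{-1}$, $\varepsilon(K_0)=1$. $\mathbb C[\mathrm{Mat}_{m,n}]_q$ is a $U_q\mathfrak s(\mathfrak{gl}(n)\oplus\mathfrak{gl}(m))$-module algebra (the multiplication is a module morphism and $\xi(1)=\varepsilon(\xi)1$) with the action on generators: $K_0z_a^\alpha=q^{n+m}z_a^\alpha$; $(K_i\otimes1)z_a^\alpha=qz_a^\alpha$ if $a=i$, $q^{-1}z_a^\alpha$ if $a=i+1$, $z_a^\alpha$ otherwise; $(1\otimes K_j)z_a^\alpha=qz_a^\alpha$ if $\alpha=m-j$, $q^{-1}z_a^\alpha$ if $\alpha=m-j+1$, $z_a^\alpha$ otherwise; $(F_i\otimes1)z_a^\alpha=q^{1/2}z_{a+1}^\alpha$ if $a=i$, $0$ otherwise; $(1\otimes F_j)z_a^\alpha=q^{1/2}z_a^{\alpha+1}$ if $\alpha=m-j$, $0$ otherwise; $(E_i\otimes1)z_a^\alpha=q^{-1/2}z_{a-1}^\alpha$ if $a=i+1$, $0$ otherwise; $(1\otimes E_j)z_a^\alpha=q^{-1/2}z_a^{\alpha-1}$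 if $\alpha=m-j+1$, $0$ otherwise. $U_q\mathfrak s(\mathfrak u(n)\oplus\mathfrak u(m))$ is the $*$-Hopf algebra $(U_q\mathfrak s(\mathfrak{gl}(n)\oplus\mathfrak{gl}(m)),* )$ with $(E_i\otimes1)^*=K_iF_i\otimes1$, $(F_i\otimes1)^*=E_iK_i^{-1}\otimes1$, $(K_i^{\pm1}\otimes1)^*=K_i^{\pm1}\otimes1$, $(1\otimes E_j)^*=1\otimes K_jF_j$, $(1\otimes F_j)^*=1\otimes E_jK_j^{-1}$, $(1\otimes K_j^{\pm1})^*=1\otimes K_j^{\pm1}$, $K_0^*=K_0$. *)

(* Defs.v *)
From HB Require Import structures.
From mathcomp Require Import all_boot all_order all_algebra.
From mathcomp Require Import boolp reals complex.

Set Implicit Arguments.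
Unset Strict Implicit.
Unset Printing Implicit Defensive.

Import Order.TTheory GRing.Theory Num.Theory.

Local Open Scope ring_scope.
Local Open Scope quotient_scope.
Local Open Scope complex_scope.

Section PresentedAlgebra.

Variables (K : fieldType) (X : Type).

Inductive alg_term : Type :=
| AGen of X
| AZero
| AOne
| AAdd of alg_term & alg_term
| AScale of K & alg_term
| AMul of alg_term & alg_term.

HB.instance Definition _ := gen_eqMixin alg_term.
HB.instance Definition _ := gen_choiceMixin alg_term.

Variable rel : alg_term -> alg_term -> Prop.

(* The least congruence that contains [rel] and the identities of unital
   associative algebras. *)
Inductive alg_cong : alg_term -> alg_term -> Prop :=
| acong_rel s t of rel s t : alg_cong s t
| acong_refl t : alg_cong t t
| acong_sym s t of alg_cong s t : alg_cong t s
| acong_trans s t u of alg_cong s t & alg_cong t u : alg_cong s u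
| acong_add s s' t t' of alg_cong s s' & alg_cong t t' :
    alg_cong (AAdd s t) (AAdd s' t')
| acong_scale c t t' of alg_cong t t' : alg_cong (AScale c t) (AScale c t')
| acong_mul s s' t t' of alg_cong s s' & alg_cong t t' :
    alg_cong (AMul s t) (AMul s' t')
| acong_addA s t u : alg_cong (AAdd s (AAdd t u)) (AAdd (AAdd s t) u)
| acong_addC s t : alg_cong (AAdd s t) (AAdd t s)
| acong_add0 t : alg_cong (AAdd AZero t) t
| acong_addN t : alg_cong (AAdd (AScale (-1) t) t) AZero
| acong_scaleA c e t : alg_cong (AScale c (AScale e t)) (AScale (c * e) t)
| acong_scale1 t : alg_cong (AScale 1 t) t
| acong_scaleDr c s t :
    alg_cong (AScale c (AAdd s t)) (AAdd (AScale c s) (AScale c t))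
| acong_scaleDl c e t :
    alg_cong (AScale (c + e) t) (AAdd (AScale c t) (AScale e t))
| acong_mulA s t u : alg_cong (AMul s (AMul t u)) (AMul (AMul s t) u)
| acong_1mul t : alg_cong (AMul AOne t) t
| acong_mul1 t : alg_cong (AMul t AOne) t
| acong_mulDl s t u : alg_cong (AMul (AAdd s t) u) (AAdd (AMul s u) (AMul t u))
| acong_mulDr s t u : alg_cong (AMul s (AAdd t u)) (AAdd (AMul s t) (AMul s u))
| acong_scaleAl c s t : alg_cong (AScale c (AMul s t)) (AMul (AScale c s) t)
| acong_scaleAr c s t : alg_cong (AScale c (AMul s t)) (AMul s (AScale c t)).

Definition alg_congb (s t : alg_term) : bool := `[< alg_cong s t >].

Fact alg_congb_equiv : equiv_class_of alg_congb.
Proof.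
split=> [t|s t|s t u].
- exact/asboolP/acong_refl.
- by apply/asboolP/asboolP; apply: acong_sym.
- by move=> /asboolP st /asboolP tu; apply/asboolP/(acong_trans st tu).
Qed.

Canonical alg_cong_rel := EquivRelPack alg_congb_equiv.

Definition palg := {eq_quot alg_cong_rel}.
HB.instance Definition _ := EqQuotient.on palg.
HB.instance Definition _ := Choice.on palg.

Definition palg_pi (t : alg_term) : palg := \pi_palg t.

Lemma palg_piP s t : palg_pi s = palg_pi t <-> alg_cong s t.
Proof. by split=> [/eqmodP/asboolP|st]; last exact/eqmodP/asboolP. Qed.

Lemma palg_repr (x : palg) : palg_pi (repr x) = x.
Proof. exact: reprK. Qed.

Lemma palg_ex (x : palg) : exists t, x = palg_pi t.
Proof. by exists (repr x); rewrite palg_repr. Qed.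

Lemma palg_repr_cong t : alg_cong (repr (palg_pi t)) t.
Proof. by apply/palg_piP; rewrite palg_repr. Qed.

Definition palg_add (x y : palg) := palg_pi (AAdd (repr x) (repr y)).
Definition palg_scale (c : K) (x : palg) := palg_pi (AScale c (repr x)).
Definition palg_mul (x y : palg) := palg_pi (AMul (repr x) (repr y)).

Lemma palg_addE s t : palg_add (palg_pi s) (palg_pi t) = palg_pi (AAdd s t).
Proof. by apply/palg_piP/acong_add; apply: palg_repr_cong. Qed.

Lemma palg_scaleE c t : palg_scale c (palg_pi t) = palg_pi (AScale c t).
Proof. exact/palg_piP/acong_scale/palg_repr_cong. Qed.

Lemma palg_mulE s t : palg_mul (palg_pi s) (palg_pi t) = palg_pi (AMul s t).
Proof. by apply/palg_piP/acong_mul; apply: palg_repr_cong. Qed.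

Let palgE := (palg_addE, palg_scaleE, palg_mulE).

Fact palg_addA : associative palg_add.
Proof.
move=> x y z; have [[s ->] [t ->] [u ->]] :=
  And3 (palg_ex x) (palg_ex y) (palg_ex z).
by rewrite !palgE; apply/palg_piP; constructor.
Qed.

Fact palg_addC : commutative palg_add.
Proof.
move=> x y; have [s ->] := palg_ex x; have [t ->] := palg_ex y.
by rewrite !palgE; apply/palg_piP/acong_addC.
Qed.

Fact palg_add0 : left_id (palg_pi AZero) palg_add.
Proof.
by move=> x; have [s ->] := palg_ex x;
   rewrite !palgE; apply/palg_piP; constructor.
Qed.

Fact palg_addN : left_inverse (palg_pi AZero) (palg_scale (-1)) palg_add.
Proof.
by move=> x; have [s ->] := palg_ex x;
   rewrite !palgE; apply/palg_piP; constructor.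
Qed.

HB.instance Definition _ :=
  GRing.isZmodule.Build palg palg_addA palg_addC palg_add0 palg_addN.

Fact palg_mulA : associative palg_mul.
Proof.
move=> x y z; have [[s ->] [t ->] [u ->]] :=
  And3 (palg_ex x) (palg_ex y) (palg_ex z).
by rewrite !palgE; apply/palg_piP; constructor.
Qed.

Fact palg_1mul : left_id (palg_pi AOne) palg_mul.
Proof.
by move=> x; have [s ->] := palg_ex x;
   rewrite !palgE; apply/palg_piP; constructor.
Qed.

Fact palg_mul1 : right_id (palg_pi AOne) palg_mul.
Proof.
by move=> x; have [s ->] := palg_ex x;
   rewrite !palgE; apply/palg_piP; constructor.
Qed.

Fact palg_mulDl : left_distributive palg_mul palg_add.
Proof.
move=> x y z; have [[s ->] [t ->] [u ->]] :=
  And3 (palg_ex x) (palg_ex y) (palg_ex z).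
by rewrite !palgE; apply/palg_piP; constructor.
Qed.

Fact palg_mulDr : right_distributive palg_mul palg_add.
Proof.
move=> x y z; have [[s ->] [t ->] [u ->]] :=
  And3 (palg_ex x) (palg_ex y) (palg_ex z).
by rewrite !palgE; apply/palg_piP; constructor.
Qed.

HB.instance Definition _ := GRing.Zmodule_isPzRing.Build palg
  palg_mulA palg_1mul palg_mul1 palg_mulDl palg_mulDr.

Fact palg_scaleA c e x : palg_scale c (palg_scale e x) = palg_scale (c * e) x.
Proof.
by have [s ->] := palg_ex x; rewrite !palgE; apply/palg_piP; constructor.
Qed.

Fact palg_scale1 : left_id 1 palg_scale.
Proof.
by move=> x; have [s ->] := palg_ex x;
   rewrite !palgE; apply/palg_piP; constructor.
Qed.

Fact palg_scaleDr : right_distributive palg_scale +%R.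
Proof.
move=> c x y; have [s ->] := palg_ex x; have [t ->] := palg_ex y.
by rewrite /GRing.add /= !palgE; apply/palg_piP; constructor.
Qed.

Fact palg_scaleDl x : {morph palg_scale^~ x : c e / c + e}.
Proof.
move=> c e; have [s ->] := palg_ex x.
by rewrite [RHS]/GRing.add /= !palgE; apply/palg_piP; constructor.
Qed.

HB.instance Definition _ := GRing.Zmodule_isLmodule.Build K palg
  palg_scaleA palg_scale1 palg_scaleDr palg_scaleDl.

Fact palg_scaleAl (c : K) (x y : palg) : c *: (x * y) = (c *: x) * y.
Proof.
have [s ->] := palg_ex x; have [t ->] := palg_ex y.
by rewrite /GRing.scale /GRing.mul /= !palgE; apply/palg_piP; constructor.
Qed.

Fact palg_scaleAr (c : K) (x y : palg) : c *: (x * y) = x * (c *: y).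
Proof.
have [s ->] := palg_ex x; have [t ->] := palg_ex y.
by rewrite /GRing.scale /GRing.mul /= !palgE; apply/palg_piP; constructor.
Qed.

Definition palg_gen (x : X) : palg := palg_pi (AGen x).

End PresentedAlgebra.

(* [algType], hence [{lrmorphism _ -> _}], demands [1 != 0] in the algebra,
   which presentations by generators and relations need not guarantee. *)
Definition alg_morphism (K : fieldType) (X Y : Type)
    (r : alg_term K X -> alg_term K X -> Prop)
    (r' : alg_term K Y -> alg_term K Y -> Prop) (f : palg r -> palg r') :=
  linear f /\ monoid_morphism f.

Declare Scope alg_term_scope.
Delimit Scope alg_term_scope with AT.
Bind Scope alg_term_scope with alg_term.
Notation "s + t" := (AAdd s t) : alg_term_scope.
Notation "s - t" := (AAdd s (AScale (-1) t)) : alg_term_scope.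
Notation "s * t" := (AMul s t) : alg_term_scope.
Notation "c *: t" := (AScale c t) : alg_term_scope.
Notation "1" := (AOne _ _) : alg_term_scope.
Notation "0" := (AZero _ _) : alg_term_scope.

(* Relations that make [iota] a morphism of unital algebras. *)
Inductive copy_rel (K : fieldType) (X Y : Type)
    (r : alg_term K X -> alg_term K X -> Prop) (iota : palg r -> alg_term K Y) :
    alg_term K Y -> alg_term K Y -> Prop :=
| copy_add a b : copy_rel iota (iota (a + b)) (iota a + iota b)%AT
| copy_scale c a : copy_rel iota (iota (c *: a)) (c *: iota a)%AT
| copy_one : copy_rel iota (iota 1) 1%AT
| copy_mul a b : copy_rel iota (iota (a * b)) (iota a * iota b)%AT.

(* The tensor product of two unital algebras is the algebra generated by a copy
   of each, subject to the two copies commuting elementwise. *)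
Section TensorProduct.

Variables (K : fieldType) (X Y : Type).
Variables (r : alg_term K X -> alg_term K X -> Prop).
Variables (r' : alg_term K Y -> alg_term K Y -> Prop).

Local Notation A := (palg r).
Local Notation B := (palg r').

Let inA (a : A) : alg_term K (A + B) := AGen K (inl a).
Let inB (b : B) : alg_term K (A + B) := AGen K (inr b).

Inductive tensor_rel : alg_term K (A + B) -> alg_term K (A + B) -> Prop :=
| tensor_left s t of copy_rel inA s t : tensor_rel s t
| tensor_right s t of copy_rel inB s t : tensor_rel s t
| tensor_comm a b : tensor_rel (inA a * inB b)%AT (inB b * inA a)%AT.

Definition tensor (a : A) (b : B) : palg tensor_rel :=
  palg_gen tensor_rel (inl a) * palg_gen tensor_rel (inr b).

End TensorProduct.

Arguments tensor_rel {K X Y} r r' _ _.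

Notation "a ⊗ b" := (tensor a b) (at level 40, left associativity) : ring_scope.

Section AdjoinInvertible.

Variables (K : fieldType) (X : Type) (r : alg_term K X -> alg_term K X -> Prop).

Local Notation A := (palg r).

Inductive adjoin_gen : Type := AdjoinElt of A | AdjoinK | AdjoinKV.

Let inA (a : A) : alg_term K adjoin_gen := AGen K (AdjoinElt a).
Let k : alg_term K adjoin_gen := AGen K AdjoinK.
Let kV : alg_term K adjoin_gen := AGen K AdjoinKV.

Inductive adjoin_rel : alg_term K adjoin_gen -> alg_term K adjoin_gen -> Prop :=
| adjoin_copy s t of copy_rel inA s t : adjoin_rel s t
| adjoin_kkV : adjoin_rel (k * kV)%AT 1%AT
| adjoin_kVk : adjoin_rel (kV * k)%AT 1%AT
| adjoin_comm a : adjoin_rel (k * inA a)%AT (inA a * k)%AT.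

End AdjoinInvertible.

Arguments adjoin_rel {K X} r _ _.

(* Indices are 0-based: [matq_z q a alpha] is z_{a+1}^{alpha+1}. *)
Section QuantumMatrices.

Variables (K : fieldType) (q : K) (m n : nat).

Local Notation z a alpha := (AGen K (a : 'I_n, alpha : 'I_m)).

Inductive matq_rel :
    alg_term K ('I_n * 'I_m) -> alg_term K ('I_n * 'I_m) -> Prop :=
| matq_rel_a (a : 'I_n) (alpha beta : 'I_m) of (alpha < beta)%N :
    matq_rel (z a alpha * z a beta)%AT (q *: (z a beta * z a alpha))%AT
| matq_rel_alpha (a b : 'I_n) (alpha : 'I_m) of (a < b)%N :
    matq_rel (z a alpha * z b alpha)%AT (q *: (z b alpha * z a alpha))%AT
| matq_rel_comm (a b : 'I_n) (alpha beta : 'I_m)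
    of (a < b)%N & (beta < alpha)%N :
    matq_rel (z a alpha * z b beta)%AT (z b beta * z a alpha)%AT
| matq_rel_cross (a b : 'I_n) (alpha beta : 'I_m)
    of (a < b)%N & (alpha < beta)%N :
    matq_rel (z a alpha * z b beta)%AT
             (z b beta * z a alpha + (q - q^-1) *: (z a beta * z b alpha))%AT.

Definition matq := palg matq_rel.
HB.instance Definition _ := GRing.PzRing.on matq.
HB.instance Definition _ := GRing.Lmodule.on matq.

Definition matq_z (a : 'I_n) (alpha : 'I_m) : matq :=
  palg_gen matq_rel (a, alpha).

End QuantumMatrices.

Section PresentedBimodule.

Variables (K : fieldType) (Y : Type) (r : alg_term K Y -> alg_term K Y -> Prop).
Variable X : Type.

Local Notation A := (palg r).

Inductive bim_term : Type :=
| BGen of X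
| BZero
| BAdd of bim_term & bim_term
| BLeft of A & bim_term
| BRight of bim_term & A.

HB.instance Definition _ := gen_eqMixin bim_term.
HB.instance Definition _ := gen_choiceMixin bim_term.

Definition BSum (I : finType) (t : I -> bim_term) : bim_term :=
  \big[BAdd/BZero]_i t i.

Variable rel : bim_term -> bim_term -> Prop.

(* The least congruence that contains [rel] and the identities of bimodules
   over a K-algebra, on which the scalars act centrally. *)
Inductive bim_cong : bim_term -> bim_term -> Prop :=
| bcong_rel s t of rel s t : bim_cong s t
| bcong_refl t : bim_cong t t
| bcong_sym s t of bim_cong s t : bim_cong t s
| bcong_trans s t u of bim_cong s t & bim_cong t u : bim_cong s u
| bcong_add s s' t t' of bim_cong s s' & bim_cong t t' :
    bim_cong (BAdd s t) (BAdd s' t')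
| bcong_left a t t' of bim_cong t t' : bim_cong (BLeft a t) (BLeft a t')
| bcong_right a t t' of bim_cong t t' : bim_cong (BRight t a) (BRight t' a)
| bcong_addA s t u : bim_cong (BAdd s (BAdd t u)) (BAdd (BAdd s t) u)
| bcong_addC s t : bim_cong (BAdd s t) (BAdd t s)
| bcong_add0 t : bim_cong (BAdd BZero t) t
| bcong_addN t : bim_cong (BAdd (BLeft (-1) t) t) BZero
| bcong_leftA a b t : bim_cong (BLeft a (BLeft b t)) (BLeft (a * b) t)
| bcong_left1 t : bim_cong (BLeft 1 t) t
| bcong_leftDr a s t :
    bim_cong (BLeft a (BAdd s t)) (BAdd (BLeft a s) (BLeft a t))
| bcong_leftDl a b t :
    bim_cong (BLeft (a + b) t) (BAdd (BLeft a t) (BLeft b t))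
| bcong_rightA a b t : bim_cong (BRight (BRight t a) b) (BRight t (a * b))
| bcong_right1 t : bim_cong (BRight t 1) t
| bcong_rightDl a s t :
    bim_cong (BRight (BAdd s t) a) (BAdd (BRight s a) (BRight t a))
| bcong_rightDr a b t :
    bim_cong (BRight t (a + b)) (BAdd (BRight t a) (BRight t b))
| bcong_leftright a b t : bim_cong (BRight (BLeft a t) b) (BLeft a (BRight t b))
| bcong_central (c : K) t :
    bim_cong (BLeft (c *: (1 : A)) t) (BRight t (c *: (1 : A))).

Definition bim_congb (s t : bim_term) : bool := `[< bim_cong s t >].

Fact bim_congb_equiv : equiv_class_of bim_congb.
Proof.
split=> [t|s t|s t u].
- exact/asboolP/bcong_refl.
- by apply/asboolP/asboolP; apply: bcong_sym.
- by move=> /asboolP st /asboolP tu; apply/asboolP/(bcong_trans st tu).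
Qed.

Canonical bim_cong_rel := EquivRelPack bim_congb_equiv.

Definition pbim := {eq_quot bim_cong_rel}.
HB.instance Definition _ := EqQuotient.on pbim.
HB.instance Definition _ := Choice.on pbim.

Definition pbim_pi (t : bim_term) : pbim := \pi_pbim t.

Lemma pbim_piP s t : pbim_pi s = pbim_pi t <-> bim_cong s t.
Proof. by split=> [/eqmodP/asboolP|st]; last exact/eqmodP/asboolP. Qed.

Lemma pbim_repr (x : pbim) : pbim_pi (repr x) = x.
Proof. exact: reprK. Qed.

Lemma pbim_ex (x : pbim) : exists t, x = pbim_pi t.
Proof. by exists (repr x); rewrite pbim_repr. Qed.

Lemma pbim_repr_cong t : bim_cong (repr (pbim_pi t)) t.
Proof. by apply/pbim_piP; rewrite pbim_repr. Qed.

Definition pbim_add (x y : pbim) := pbim_pi (BAdd (repr x) (repr y)).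
Definition lact (a : A) (x : pbim) := pbim_pi (BLeft a (repr x)).
Definition ract (x : pbim) (a : A) := pbim_pi (BRight (repr x) a).
Definition pbim_scale (c : K) (x : pbim) := lact (c *: (1 : A)) x.

Lemma pbim_addE s t : pbim_add (pbim_pi s) (pbim_pi t) = pbim_pi (BAdd s t).
Proof. by apply/pbim_piP/bcong_add; apply: pbim_repr_cong. Qed.

Lemma pbim_lactE a t : lact a (pbim_pi t) = pbim_pi (BLeft a t).
Proof. exact/pbim_piP/bcong_left/pbim_repr_cong. Qed.

Lemma pbim_ractE t a : ract (pbim_pi t) a = pbim_pi (BRight t a).
Proof. exact/pbim_piP/bcong_right/pbim_repr_cong. Qed.

Let pbimE := (pbim_addE, pbim_lactE, pbim_ractE).

Fact pbim_addA : associative pbim_add.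
Proof.
move=> x y z; have [[s ->] [t ->] [u ->]] :=
  And3 (pbim_ex x) (pbim_ex y) (pbim_ex z).
by rewrite !pbimE; apply/pbim_piP; constructor.
Qed.

Fact pbim_addC : commutative pbim_add.
Proof.
move=> x y; have [s ->] := pbim_ex x; have [t ->] := pbim_ex y.
by rewrite !pbimE; apply/pbim_piP/bcong_addC.
Qed.

Fact pbim_add0 : left_id (pbim_pi BZero) pbim_add.
Proof.
by move=> x; have [s ->] := pbim_ex x;
   rewrite !pbimE; apply/pbim_piP; constructor.
Qed.

Fact pbim_addN : left_inverse (pbim_pi BZero) (lact (-1)) pbim_add.
Proof.
by move=> x; have [s ->] := pbim_ex x;
   rewrite !pbimE; apply/pbim_piP; constructor.
Qed.

HB.instance Definition _ :=
  GRing.isZmodule.Build pbim pbim_addA pbim_addC pbim_add0 pbim_addN.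

Lemma lactA a b x : lact a (lact b x) = lact (a * b) x.
Proof.
by have [s ->] := pbim_ex x; rewrite !pbimE; apply/pbim_piP; constructor.
Qed.

Lemma lact1 x : lact 1 x = x.
Proof.
by have [s ->] := pbim_ex x; rewrite !pbimE; apply/pbim_piP; constructor.
Qed.

Lemma lactDr a x y : lact a (x + y) = lact a x + lact a y.
Proof.
have [s ->] := pbim_ex x; have [t ->] := pbim_ex y.
by rewrite /GRing.add /= !pbimE; apply/pbim_piP; constructor.
Qed.

Lemma lactDl a b x : lact (a + b) x = lact a x + lact b x.
Proof.
have [s ->] := pbim_ex x.
by rewrite [RHS]/GRing.add /= !pbimE; apply/pbim_piP; constructor.
Qed.

Lemma ractA x a b : ract (ract x a) b = ract x (a * b).
Proof.
by have [s ->] := pbim_ex x; rewrite !pbimE; apply/pbim_piP; constructor.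
Qed.

Lemma ract1 x : ract x 1 = x.
Proof.
by have [s ->] := pbim_ex x; rewrite !pbimE; apply/pbim_piP; constructor.
Qed.

Lemma ractDl x y a : ract (x + y) a = ract x a + ract y a.
Proof.
have [s ->] := pbim_ex x; have [t ->] := pbim_ex y.
by rewrite /GRing.add /= !pbimE; apply/pbim_piP; constructor.
Qed.

Lemma ractDr x a b : ract x (a + b) = ract x a + ract x b.
Proof.
have [s ->] := pbim_ex x.
by rewrite [RHS]/GRing.add /= !pbimE; apply/pbim_piP; constructor.
Qed.

Lemma lact_ract a x b : ract (lact a x) b = lact a (ract x b).
Proof.
by have [s ->] := pbim_ex x; rewrite !pbimE; apply/pbim_piP; constructor.
Qed.

Fact pbim_scaleA c e x : pbim_scale c (pbim_scale e x) = pbim_scale (c * e) x.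
Proof.
by rewrite /pbim_scale lactA -palg_scaleAl mul1r scalerA.
Qed.

Fact pbim_scale1 : left_id 1 pbim_scale.
Proof. by move=> x; rewrite /pbim_scale scale1r lact1. Qed.

Fact pbim_scaleDr : right_distributive pbim_scale +%R.
Proof. by move=> c x y; exact: lactDr. Qed.

Fact pbim_scaleDl x : {morph pbim_scale^~ x : c e / c + e}.
Proof. by move=> c e; rewrite /pbim_scale scalerDl lactDl. Qed.

HB.instance Definition _ := GRing.Zmodule_isLmodule.Build K pbim
  pbim_scaleA pbim_scale1 pbim_scaleDr pbim_scaleDl.

Lemma lact_scalar c x : lact (c *: (1 : A)) x = c *: x.
Proof. by []. Qed.

Lemma ract_scalar c x : ract x (c *: (1 : A)) = c *: x.
Proof.
rewrite -lact_scalar; have [s ->] := pbim_ex x.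
by rewrite !pbimE; apply/pbim_piP/bcong_sym/bcong_central.
Qed.

Definition pbim_gen (x : X) : pbim := pbim_pi (BGen x).

End PresentedBimodule.

Section QuantumDifferentials.

Variables (K : fieldType) (q : K) (m n : nat).

(* [Rcoef q b a b' a'] is $R_{ba}^{b'a'}$. *)
Definition Rcoef (k : nat) (b a b' a' : 'I_k) : K :=
  if [&& a == b, b == a' & a' == b'] then q^-1
  else if [&& a != b, a == a' & b == b'] then 1
  else if [&& (a < b)%N, a == b' & b == a'] then q^-1 - q
  else 0.

Local Notation term := (bim_term (@matq_rel K q m n) ('I_n * 'I_m)).
Local Notation dzg a alpha := (BGen (@matq_rel K q m n) (a : 'I_n, alpha : 'I_m)).

Inductive omega1_rel : term -> term -> Prop :=
| omega1_rel_z (a b : 'I_n) (alpha beta : 'I_m) :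
    omega1_rel
      (BLeft (matq_z q b beta) (dzg a alpha))
      (BSum (fun alpha' : 'I_m => BSum (fun beta' : 'I_m =>
       BSum (fun a' : 'I_n => BSum (fun b' : 'I_n =>
         BLeft ((Rcoef beta alpha beta' alpha' * Rcoef b a b' a')
                  *: (1 : matq q m n))
           (BRight (dzg a' alpha') (matq_z q b' beta'))))))).

Definition omega1 := pbim omega1_rel.
HB.instance Definition _ := GRing.Lmodule.on omega1.

Definition dz (a : 'I_n) (alpha : 'I_m) : omega1 :=
  pbim_gen omega1_rel (a, alpha).

Definition is_differential (d : matq q m n -> omega1) : Prop :=
  [/\ linear d,
      forall a alpha, d (matq_z q a alpha) = dz a alpha
    & forall f g, d (f * g) = ract (d f) g + lact f (d g)].

(* [pd a alpha f] is the partial derivative of [f] along z_a^alpha. *)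
Definition are_partials (d : matq q m n -> omega1)
    (pd : 'I_n -> 'I_m -> matq q m n -> matq q m n) : Prop :=
  forall f, d f = \sum_a \sum_alpha lact (pd a alpha f) (dz a alpha).

End QuantumDifferentials.

Section QuantumGroup.

Variables (K : fieldType) (q : K).

Section UqSl.

Variable k : nat.

Inductive uq_gen : Type :=
| UqE of 'I_k.-1
| UqF of 'I_k.-1
| UqK of 'I_k.-1
| UqKV of 'I_k.-1.

Definition cartan (i j : 'I_k.-1) : int :=
  if i == j then 2
  else if ((i == j.+1 :> nat) || (j == i.+1 :> nat))%N then -1
  else 0.

Local Notation E i := (AGen K (UqE i)).
Local Notation F i := (AGen K (UqF i)).
Local Notation Kg i := (AGen K (UqK i)).
Local Notation KV i := (AGen K (UqKV i)).

Inductive uq_rel : alg_term K uq_gen -> alg_term K uq_gen -> Prop :=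
| uq_KKV i : uq_rel (Kg i * KV i)%AT 1%AT
| uq_KVK i : uq_rel (KV i * Kg i)%AT 1%AT
| uq_KK i j : uq_rel (Kg i * Kg j)%AT (Kg j * Kg i)%AT
| uq_KE i j : uq_rel (Kg i * E j)%AT (q ^ cartan i j *: (E j * Kg i))%AT
| uq_KF i j : uq_rel (Kg i * F j)%AT (q ^ (- cartan i j) *: (F j * Kg i))%AT
| uq_EF i j :
    uq_rel (E i * F j - F j * E i)%AT
           (((i == j)%:R / (q - q^-1)) *: (Kg i - KV i))%AT
| uq_serreE0 i j of cartan i j = 0 : uq_rel (E i * E j)%AT (E j * E i)%AT
| uq_serreE1 i j of cartan i j = -1 :
    uq_rel (E i * E i * E j - (q + q^-1) *: (E i * E j * E i)
            + E j * E i * E i)%AT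
           0%AT
| uq_serreF0 i j of cartan i j = 0 : uq_rel (F i * F j)%AT (F j * F i)%AT
| uq_serreF1 i j of cartan i j = -1 :
    uq_rel (F i * F i * F j - (q + q^-1) *: (F i * F j * F i)
            + F j * F i * F i)%AT
           0%AT.

Definition uq_sl := palg uq_rel.

End UqSl.

Variables (n m : nat).

Definition uq_slsl_rel := tensor_rel (@uq_rel n) (@uq_rel m).
Definition uq_slsl := palg uq_slsl_rel.

Definition uq_sgl_rel := adjoin_rel uq_slsl_rel.
Definition uq_sgl := palg uq_sgl_rel.
HB.instance Definition _ := GRing.PzRing.on uq_sgl.
HB.instance Definition _ := GRing.Lmodule.on uq_sgl.

Definition uq_sgl2 := palg (tensor_rel uq_sgl_rel uq_sgl_rel).
HB.instance Definition _ := GRing.PzRing.on uq_sgl2.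
HB.instance Definition _ := GRing.Lmodule.on uq_sgl2.

(* The index [inl i] stands for [x_i ⊗ 1], and [inr j] for [1 ⊗ x_j]. *)
Definition uq_elt (x : forall k, 'I_k.-1 -> uq_gen k)
    (s : 'I_n.-1 + 'I_m.-1) : uq_sgl :=
  palg_gen uq_sgl_rel (AdjoinElt (match s with
  | inl i => palg_gen (@uq_rel n) (x n i) ⊗ 1
  | inr j => 1 ⊗ palg_gen (@uq_rel m) (x m j)
  end)).

Definition uE := uq_elt UqE.
Definition uF := uq_elt UqF.
Definition uK := uq_elt UqK.
Definition uKV := uq_elt UqKV.
Definition uK0 : uq_sgl := palg_gen uq_sgl_rel (AdjoinK _).
Definition uK0V : uq_sgl := palg_gen uq_sgl_rel (AdjoinKV _).

Record is_hopf (Delta : uq_sgl -> uq_sgl2)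
    (S : uq_sgl -> uq_sgl) (eps : uq_sgl -> K) : Prop := IsHopf {
  hopf_Delta : alg_morphism Delta;
  hopf_DeltaE : forall s, Delta (uE s) = uE s ⊗ 1 + uK s ⊗ uE s;
  hopf_DeltaF : forall s, Delta (uF s) = uF s ⊗ uKV s + 1 ⊗ uF s;
  hopf_DeltaK : forall s, Delta (uK s) = uK s ⊗ uK s;
  hopf_DeltaK0 : Delta uK0 = uK0 ⊗ uK0;
  hopf_S : linear S;
  hopf_S1 : S 1 = 1;
  hopf_SM : forall x y, S (x * y) = S y * S x;
  hopf_SE : forall s, S (uE s) = - (uKV s * uE s);
  hopf_SF : forall s, S (uF s) = - (uF s * uK s);
  hopf_SK : forall s, S (uK s) = uKV s;
  hopf_SK0 : S uK0 = uK0V;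
  hopf_eps : scalar eps;
  hopf_epsM : monoid_morphism eps;
  hopf_epsE : forall s, eps (uE s) = 0;
  hopf_epsF : forall s, eps (uF s) = 0;
  hopf_epsK : forall s, eps (uK s) = 1;
  hopf_epsK0 : eps uK0 = 1
}.

End QuantumGroup.

Section Action.

Variables (K : fieldType) (q : K) (n m : nat).

Local Notation U := (uq_sgl q n m).
Local Notation A := (matq q m n).

(* Compatibility with the product is stated on an arbitrary decomposition of
   [Delta xi] into pure tensors; every element of a tensor product has one. *)
Record is_module_algebra (Delta : U -> uq_sgl2 q n m) (eps : U -> K)
    (act : U -> A -> A) : Prop := IsModuleAlgebra {
  act_linear : forall xi, linear (act xi);
  act_linearl : forall P, linear (act^~ P);
  act1 : forall P, act 1 P = P;
  actM : forall xi eta P, act (xi * eta) P = act xi (act eta P);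
  act_mul : forall xi (s : seq (U * U)),
    Delta xi = \sum_(x <- s) x.1 ⊗ x.2 ->
    forall P Q, act xi (P * Q) = \sum_(x <- s) act x.1 P * act x.2 Q;
  act_unit : forall xi, act xi 1 = eps xi *: (1 : A)
}.

(* [r] is the square root of [q]; [i.+1], [j.+1], [a.+1], [alpha.+1] are the
   usual 1-based indices. *)
Record acts_on_generators (r : K) (act : U -> A -> A) : Prop :=
    ActsOnGenerators {
  act_K0 : forall a alpha,
    act (uK0 q n m) (matq_z q a alpha) = q ^+ (n + m) *: matq_z q a alpha;
  act_Kl : forall (i : 'I_n.-1) (a : 'I_n) (alpha : 'I_m),
    act (uK q (inl i)) (matq_z q a alpha) =
      (if a.+1 == i.+1 then q else if a.+1 == i.+2 then q^-1 else 1)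
        *: matq_z q a alpha;
  act_Kr : forall (j : 'I_m.-1) (a : 'I_n) (alpha : 'I_m),
    act (uK q (inr j)) (matq_z q a alpha) =
      (if alpha.+1 == (m - j.+1)%N then q
       else if alpha.+1 == (m - j.+1).+1 then q^-1 else 1) *: matq_z q a alpha;
  act_Fl : forall (i : 'I_n.-1) (a : 'I_n) (alpha : 'I_m) (a' : 'I_n),
    a.+1 = i.+1 -> a' = a.+1 :> nat ->
    act (uF q (inl i)) (matq_z q a alpha) = r *: matq_z q a' alpha;
  act_Fl0 : forall (i : 'I_n.-1) (a : 'I_n) (alpha : 'I_m),
    a.+1 <> i.+1 -> act (uF q (inl i)) (matq_z q a alpha) = 0;
  act_Fr : forall (j : 'I_m.-1) (a : 'I_n) (alpha : 'I_m) (alpha' : 'I_m),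
    alpha.+1 = (m - j.+1)%N -> alpha' = alpha.+1 :> nat ->
    act (uF q (inr j)) (matq_z q a alpha) = r *: matq_z q a alpha';
  act_Fr0 : forall (j : 'I_m.-1) (a : 'I_n) (alpha : 'I_m),
    alpha.+1 <> (m - j.+1)%N -> act (uF q (inr j)) (matq_z q a alpha) = 0;
  act_El : forall (i : 'I_n.-1) (a : 'I_n) (alpha : 'I_m) (a' : 'I_n),
    a.+1 = i.+2 -> a = a'.+1 :> nat ->
    act (uE q (inl i)) (matq_z q a alpha) = r^-1 *: matq_z q a' alpha;
  act_El0 : forall (i : 'I_n.-1) (a : 'I_n) (alpha : 'I_m),
    a.+1 <> i.+2 -> act (uE q (inl i)) (matq_z q a alpha) = 0;
  act_Er : forall (j : 'I_m.-1) (a : 'I_n) (alpha : 'I_m) (alpha' : 'I_m),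
    alpha.+1 = (m - j.+1).+1 -> alpha = alpha'.+1 :> nat ->
    act (uE q (inr j)) (matq_z q a alpha) = r^-1 *: matq_z q a alpha';
  act_Er0 : forall (j : 'I_m.-1) (a : 'I_n) (alpha : 'I_m),
    alpha.+1 <> (m - j.+1).+1 -> act (uE q (inr j)) (matq_z q a alpha) = 0
}.

End Action.

Section Star.

Variables (C : numClosedFieldType) (q : C) (n m : nat).

Local Notation U := (uq_sgl q n m).

Record is_star (star : U -> U) : Prop := IsStar {
  star_add : forall x y, star (x + y) = star x + star y;
  star_scale : forall c x, star (c *: x) = c^* *: star x;
  star_mul : forall x y, star (x * y) = star y * star x;
  star_involutive : involutive star;
  star_E : forall s, star (uE q s) = uK q s * uF q s;
  star_F : forall s, star (uF q s) = uE q s * uKV q s;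
  star_K : forall s, star (uK q s) = uK q s;
  star_KV : forall s, star (uKV q s) = uKV q s;
  star_K0 : star (uK0 q n m) = uK0 q n m
}.

End Star.

(* [{dot _ for Num.conj}] is the type of positive definite Hermitian forms that
   are linear in the first argument. *)
Definition is_fock_form (C : numClosedFieldType) (q : C) (m n : nat)
    (pd : 'I_n -> 'I_m -> matq q m n -> matq q m n)
    (form : {dot (matq q m n) for (@Num.conj C)}) : Prop :=
  form (1 : matq q m n) (1 : matq q m n) = 1 /\
  forall a alpha P Q, form (pd a alpha P) Q = form P (Q * matq_z q a alpha).

(* Main.v *)
From HB Require Import structures.
Require Import Defs.
From mathcomp Require Import all_boot all_order all_algebra.
From mathcomp Require Import boolp reals complex.
From mathcomp Require Import ring zify.

Import Order.TTheory GRing.Theory Num.Theory.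
Local Open Scope ring_scope.
Local Open Scope complex_scope.

(** Write z_w for the generators, w = (a, alpha), and d_w for the partial
    derivatives.

    The set of those xi for which the claim holds for all P and Q is a
    subalgebra, because star is conjugate linear and reverses products; it is
    closed under inverses, and under star because the form is Hermitian.  So
    only K_0, the K_s and the E_s have to be treated: K_s^-1 and K_0^-1 are
    inverses, and F_s = K_s^-1 (K_s F_s) = K_s^-1 E_s^*.

    Since d_w is adjoint to right multiplication by z_w, the claim for E = E_s
    and Q z_w reduces to the claim for Q as soon as one knows how d_w commutes
    with E, namely
      d_w (E P) = E (d_w P) + sum_v c_{v,w} K (d_v P),
    where c is the matrix of E on the span of the generators.  On the other
    side K F (Q z_w) = (K F Q) z_w + (K Q) (K F z_w), and K F acts on the
    generators by the transpose of c; this is where r ^ 2 = q enters.  The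
    induction starts at Q = 1, where both sides vanish because (P z_w, 1) = 0
    by d_w 1 = 0 ([form_diag], [form_raise]).

    The commutation rule says that d intertwines the action of E on the algebra
    with the action E (f dz_w) = (E f) dz_w + (K f) (E dz_w) on differentials
    ([d_raise], [pd_raise]).  By the Leibniz rule and induction on f this
    amounts to the compatibility of the latter action with right
    multiplication by z_y.  Inverting the defining relations,
      dz_w z_y = (T_n T_m h) (w, y)   with   h (u, x) = z_u dz_x,
    where the Hecke operator
      (T g) (a, b) = q g (a, a)                                 if a = b,
                     g (b, a) + [a < b] (q - q^-1) g (a, b)     otherwise
    acts on the Latin indices (T_n) and on the Greek ones (T_m); and T commutes
    with the action of E on a tensor square ([braid_raise_tensor]).

    Reading off partial derivatives from an equality of differentials requires
    the dz_w to be free over the algebra.  This is proved by letting the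
    algebra act from the right on row vectors: the formula for dz_w z_y gives
    matrices [right_mx].  The relations of the algebra are equivalent to
    T_n G = T_m G for G (a, b, alpha, beta) = z_a^alpha z_b^beta ([frtP]), and
    the matrices satisfy the same equation by the braid relation
    T_12 T_23 T_12 = T_23 T_12 T_23 for both T_n and T_m ([braid2_frt]). *)

Set Implicit Arguments.
Unset Strict Implicit.

(** * Linear combinations in a module *)

Section LinearCombinations.
Variables (K : fieldType) (V : lmodType K).

(** Identities between linear combinations of vectors are checked one
    coefficient at a time: [lin_eq] reifies both sides over the list of the
    vectors that occur and leaves one identity in [K] per vector. *)
Inductive lin_term : Type :=
| LAtom of nat
| LZero
| LAdd of lin_term & lin_term
| LScale of K & lin_term.

Fixpoint lin_eval (s : seq V) (e : lin_term) : V :=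
  match e with
  | LAtom i => s`_i
  | LZero => 0
  | LAdd e f => lin_eval s e + lin_eval s f
  | LScale c e => c *: lin_eval s e
  end.

Fixpoint lin_coef (i : nat) (e : lin_term) : K :=
  match e with
  | LAtom j => if i == j then 1 else 0
  | LZero => 0
  | LAdd e f => lin_coef i e + lin_coef i f
  | LScale c e => c * lin_coef i e
  end.

Lemma lin_evalE (s : seq V) (e : lin_term) :
  lin_eval s e = \sum_(i < size s) lin_coef i e *: s`_i.
Proof.
elim: e => [j||e IHe f IHf|c e IHe] /=.
- have [ltj|gej] := ltnP j (size s).
    rewrite (bigD1 (Ordinal ltj)) //= eqxx scale1r big1 ?addr0 // => i.
    by rewrite -val_eqE /= => /negPf->; rewrite scale0r.
  rewrite nth_default // big1 // => i _.
  by rewrite ltn_eqF ?scale0r // (leq_trans (ltn_ord i)).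
- by rewrite big1 // => i _; rewrite scale0r.
- by rewrite IHe IHf -big_split; apply: eq_bigr => i _; rewrite scalerDl.
- by rewrite IHe scaler_sumr; apply: eq_bigr => i _; rewrite scalerA.
Qed.

Fixpoint lin_same (k : nat) (e f : lin_term) : Prop :=
  if k is k'.+1 then lin_coef k' e = lin_coef k' f /\ lin_same k' e f else True.

Lemma lin_eval_eq (s : seq V) (e f : lin_term) :
  lin_same (size s) e f -> lin_eval s e = lin_eval s f.
Proof.
move=> ef; rewrite !lin_evalE; apply: eq_bigr => -[i /= lti] _; congr (_ *: _).
move: lti ef; elim: (size s) => // k IHk; rewrite ltnS leq_eqVlt.
by case/orP=> [/eqP-> [] | ltik [_]] //; apply: IHk.
Qed.

End LinearCombinations.

Ltac lin_index x s :=
  lazymatch s with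
  | x :: _ => constr:(0%N)
  | _ :: ?t => let i := lin_index x t in constr:(i.+1)
  end.

Ltac lin_atoms e s :=
  lazymatch e with
  | 0 => s
  | ?x + ?y => let t := lin_atoms x s in lin_atoms y t
  | _ *: ?x => lin_atoms x s
  | ?x => match s with
          | _ => let i := lin_index x s in s
          | _ => constr:(x :: s)
          end
  end.

Ltac lin_reify K e s :=
  lazymatch e with
  | 0 => constr:(LZero K)
  | ?x + ?y => let u := lin_reify K x s in let v := lin_reify K y s in
               constr:(LAdd u v)
  | ?c *: ?x => let u := lin_reify K x s in constr:(@LScale K c u)
  | ?x => let i := lin_index x s in constr:(LAtom K i)
  end.

Ltac lin_eq K V :=
  rewrite -?scaleN1r;
  lazymatch goal with
  | |- ?x = ?y =>
      let s0 := constr:(@nil V) in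
      let s1 := lin_atoms x s0 in
      let s := lin_atoms y s1 in
      let u := lin_reify K x s in
      let v := lin_reify K y s in
      apply: (@lin_eval_eq K V s u v); rewrite /=; repeat split
  end.

(** Actions, differentials and partial derivatives are given as plain functions
    with a proof of linearity, hence these rules for unbundled functions. *)
Section LinearFunctions.
Variables (K : fieldType) (V W : lmodType K) (f : V -> W).
Hypothesis lf : linear f.

Lemma linear_at0 : f 0 = 0.
Proof.
by have /eqP := lf 1 0 0; rewrite !scale1r addr0 eq_sym -subr_eq0 addrK => /eqP.
Qed.

Lemma linear_atD u v : f (u + v) = f u + f v.
Proof. by rewrite -[u in LHS]scale1r lf scale1r. Qed.

Lemma linear_atZ c u : f (c *: u) = c *: f u.
Proof. by rewrite -[in LHS](addr0 (c *: u)) lf linear_at0 addr0. Qed.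

Lemma linear_at_sum (I : finType) (F : I -> V) : f (\sum_i F i) = \sum_i f (F i).
Proof.
by apply: (big_morph f) => [u v|]; [exact: linear_atD | exact: linear_at0].
Qed.

End LinearFunctions.

(** * The Hecke operator on one index *)

(** [braid] and its inverse have this shape.  It makes two facts evident for
    both at once: they commute with linear maps, and operators on disjoint
    sets of indices commute with each other. *)
Definition flip_comb (K : fieldType) (k : nat) (x y : 'I_k -> 'I_k -> K)
    (V : lmodType K) (h : 'I_k -> 'I_k -> V) (a b : 'I_k) : V :=
  x a b *: h a b + y a b *: h b a.

Lemma flip_comb_linear (K : fieldType) (k : nat) (x y : 'I_k -> 'I_k -> K)
    (V W : lmodType K) (f : V -> W) (h : 'I_k -> 'I_k -> V) a b :
  linear f -> f (flip_comb x y h a b) = flip_comb x y (fun a b => f (h a b)) a b.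
Proof.
by move=> lf; rewrite /flip_comb lf (linear_atZ lf).
Qed.

Lemma flip_combC (K : fieldType) (k l : nat) (x y : 'I_k -> 'I_k -> K)
    (x' y' : 'I_l -> 'I_l -> K) (V : lmodType K)
    (h : 'I_k -> 'I_k -> 'I_l -> 'I_l -> V) a b c d :
  flip_comb x y (fun a b => flip_comb x' y' (h a b) c d) a b =
  flip_comb x' y' (fun c d => flip_comb x y (fun a b => h a b c d) a b) c d.
Proof. by rewrite /flip_comb; lin_eq K V; ring. Qed.

Section Braiding.
Variables (K : fieldType) (q : K).

Section OneIndex.
Variable k : nat.

(** The Hecke operator T: its eigenvalues are q and - q^-1.  It describes at
    the same time the relations of the algebra and, on functions
    h (u, x) = z_u dz_x, the passage from dz z to z dz. *)
Definition braid :
    forall V : lmodType K, ('I_k -> 'I_k -> V) -> 'I_k -> 'I_k -> V :=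
  flip_comb (fun a b => if a == b then q else if (a < b)%N then q - q^-1 else 0)
      (fun a b => if a == b then 0 else 1).

(** T^-1 = T - (q - q^-1), written with the two terms collected. *)
Definition braidV :
    forall V : lmodType K, ('I_k -> 'I_k -> V) -> 'I_k -> 'I_k -> V :=
  flip_comb (fun a b => if a == b then q^-1 else if (b < a)%N then q^-1 - q else 0)
      (fun a b => if a == b then 0 else 1).

Variable V : lmodType K.
Implicit Types h : 'I_k -> 'I_k -> V.

Lemma braidVK h a b : q != 0 -> braidV (braid h) a b = h a b.
Proof.
move=> q0; rewrite /braidV /braid /flip_comb -!val_eqE /=.
by case: (ltngtP a b) => ab; lin_eq K V; field.
Qed.

Lemma braidK h a b : q != 0 -> braid (braidV h) a b = h a b.
Proof.
move=> q0; rewrite /braidV /braid /flip_comb -!val_eqE /=.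
by case: (ltngtP a b) => ab; lin_eq K V; field.
Qed.

(** The braid relation T_12 T_23 T_12 = T_23 T_12 T_23.  Each relative order of
    a, b, c gives an identity between combinations of the values of h at the
    permutations of (a, b, c). *)
Lemma braid_braid (h : 'I_k -> 'I_k -> 'I_k -> V) a b c :
  q != 0 ->
  braid (fun a b => braid (fun b c => braid (fun a b => h a b c) a b) b c) a b =
  braid (fun b c => braid (fun a b => braid (fun b c => h a b c) b c) a b) b c.
Proof.
move=> q0; rewrite /braid /flip_comb -!val_eqE /=.
case: (ltngtP a b) => ab; case: (ltngtP a c) => ac; case: (ltngtP b c) => bc;
  try by exfalso; lia.
all: repeat match goal with
  H : nat_of_ord _ = nat_of_ord _ |- _ => move/val_inj: H => ?; subst end.
all: by rewrite ?eqxx ?ltnn; lin_eq K V; field.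
Qed.

(** The bimodule relations are T^-1: the only nonzero R_{ba}^{b'a'} have
    (a', b') = (a, b) or (a', b') = (b, a). *)
Lemma braidV_Rcoef h (b a : 'I_k) :
  \sum_a' \sum_b' Rcoef q b a b' a' *: h a' b' = braidV h b a.
Proof.
have R0 a' b' : (a', b') != (a, b) -> (a', b') != (b, a) -> Rcoef q b a b' a' = 0.
  rewrite !xpair_eqE /Rcoef [b == a']eq_sym [a == a']eq_sym [b == b']eq_sym
     [a == b']eq_sym.
  case: (eqVneq a b) => [->|ab] /=.
    rewrite ltnn /=.
    by case: (eqVneq a' b) => //= ->; rewrite eq_sym => /negPf->.
  by move=> /negPf-> /negPf; rewrite andbC => ->; rewrite andbF.
rewrite pair_big /= (bigD1 (a, b)) //=.
rewrite /braidV /flip_comb.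
case: (eqVneq b a) => [eba|ab].
  subst b; rewrite big1 => [|[a' b'] ne]; last by rewrite R0 ?scale0r.
  by rewrite /Rcoef !eqxx /= scale0r !addr0.
rewrite (bigD1 (b, a)) /=; last by rewrite xpair_eqE (negPf ab).
rewrite big1 => [|[a' b'] /andP [ne1 ne2]]; last by rewrite R0 ?scale0r.
rewrite /Rcoef !eqxx [a == b]eq_sym (negPf ab) /= andbT addr0 addrC.
by case: ifP => _.
Qed.

Variable r : K.

(** The vector representation: if i0 and i1 = i0 + 1 stand for i and i + 1 and
    r is the square root of q, then [raise] is E_i and [weight] gives the
    eigenvalues of K_i.  [raise_tensor] is the coproduct E (x) 1 + K (x) E. *)
Definition raise (i0 i1 : 'I_k) (W : lmodType K) (g : 'I_k -> W) (a : 'I_k) : W :=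
  if a == i1 then r^-1 *: g i0 else 0.

Definition weight (i0 i1 a : 'I_k) : K :=
  if a == i0 then q else if a == i1 then q^-1 else 1.

Definition raise_tensor (i0 i1 : 'I_k) (W : lmodType K)
    (h : 'I_k -> 'I_k -> W) (a b : 'I_k) : W :=
  raise i0 i1 (h^~ b) a + weight i0 i1 a *: raise i0 i1 (h a) b.

(** T commutes with E (x) 1 + K (x) E.  As no index lies strictly between i0 and
    i1, an index c outside {i0, i1} compares with both in the same way, and the
    terms where c meets i0 or i1 match. *)
Lemma braid_raise_tensor (i0 i1 : 'I_k) h a b : q != 0 -> i1 = i0.+1 :> nat ->
  braid (raise_tensor i0 i1 h) a b = raise_tensor i0 i1 (braid h) a b.
Proof.
move=> q0 i01; have ne : i0 != i1 by rewrite -val_eqE /=; lia.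
have lt01 : (i0 < i1)%N by rewrite i01.
have lt10 : (i1 < i0)%N = false by apply/negbTE; lia.
have n01 : (i0 == i1) = false by apply: negbTE.
have n10 : (i1 == i0) = false by rewrite eq_sym.
have near c : c != i0 -> c != i1 ->
    (((i0 < c)%N = (i1 < c)%N) * ((c < i0)%N = (c < i1)%N)) *
    (((c == i0) = false) * ((c == i1) = false) *
     ((i0 == c) = false) * ((i1 == c) = false)).
  move=> c0 c1; rewrite ![_ == c]eq_sym (negPf c0) (negPf c1).
  by move: c0 c1; rewrite -!val_eqE /= i01; split=> //; split; lia.
rewrite /braid /flip_comb /raise_tensor /raise /weight.
have triv := (eqxx, n01, n10, lt01, lt10, ltnn); move: r^-1 => s.
have [->|a1] := eqVneq a i1; first have [->|b1] := eqVneq b i1.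
- by rewrite ?triv; lin_eq K V; field.
- have [->|b0] := eqVneq b i0; first by rewrite ?triv; lin_eq K V; field.
  by rewrite ?(near b b0 b1) ?triv; lin_eq K V; field.
have [->|a0] := eqVneq a i0.
  have [->|b1] := eqVneq b i1; first by rewrite ?triv; lin_eq K V; field.
  by rewrite ?(scaler0, addr0, add0r).
have [->|b1] := eqVneq b i1; last by rewrite ?(scaler0, addr0, add0r).
by rewrite ?(near a a0 a1) ?triv; lin_eq K V; field.
Qed.
End OneIndex.
End Braiding.

(** * The braiding on pairs of indices and the FRT equation *)

Section PairBraiding.
Variables (K : fieldType) (q : K) (n m : nat).
Local Notation X := ('I_n * 'I_m)%type.
Implicit Types V W : lmodType K.

Definition braid2 V (h : X -> X -> V) (w y : X) : V :=
  braid q (fun a b =>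
    braid q (fun al be => h (a, al) (b, be)) w.2 y.2) w.1 y.1.

Definition braidV2 V (h : X -> X -> V) (w y : X) : V :=
  braidV q (fun a b =>
    braidV q (fun al be => h (a, al) (b, be)) w.2 y.2) w.1 y.1.

Lemma eq_braid2 V (h h' : X -> X -> V) w y :
  (forall u x, h u x = h' u x) -> braid2 h w y = braid2 h' w y.
Proof. by move=> e; rewrite /braid2 /braid /flip_comb !e. Qed.

Lemma braid2_linear V W (f : V -> W) (h : X -> X -> V) w y :
  linear f -> f (braid2 h w y) = braid2 (fun u x => f (h u x)) w y.
Proof.
by move=> lf; rewrite /braid2 /braid !flip_comb_linear //; congr flip_comb;
   do 2![apply: funext => ?]; rewrite flip_comb_linear.
Qed.

Lemma braid2_sum V (I : finType) (h : I -> X -> X -> V) w y :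
  \sum_i braid2 (h i) w y = braid2 (fun u x => \sum_i h i u x) w y.
Proof.
rewrite /braid2 /braid /flip_comb big_split /= -!scaler_sumr !big_split /=.
by rewrite -!scaler_sumr.
Qed.

Lemma braid2K V (h : X -> X -> V) w y : q != 0 -> braid2 (braidV2 h) w y = h w y.
Proof.
move: w y => [a al] [b be] q0; rewrite /braid2 /braidV2 /=.
transitivity (braid q (fun a b => braidV q (fun a b => braid q (fun al be =>
    braidV q (fun al be => h (a, al) (b, be)) al be) al be) a b) a b).
  by congr (_ a b); congr braid; do 2![apply: funext => ?]; exact: flip_combC.
by rewrite !braidK.
Qed.

Lemma braidV2K V (h : X -> X -> V) w y : q != 0 -> braidV2 (braid2 h) w y = h w y.
Proof.
move: w y => [a al] [b be] q0; rewrite /braid2 /braidV2 /=.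
transitivity (braidV q (fun a b => braid q (fun a b => braidV q (fun al be =>
    braid q (fun al be => h (a, al) (b, be)) al be) al be) a b) a b).
  by congr (_ a b); congr braidV; do 2![apply: funext => ?]; exact: flip_combC.
by rewrite !braidVK.
Qed.

(** The right-hand side of the defining relation for z_b^be dz_a^al, when
    h (w, y) stands for dz_w z_y. *)
Lemma braidV2_Rcoef V (h : X -> X -> V) (b a : 'I_n) (be al : 'I_m) :
  \sum_al' \sum_be' \sum_a' \sum_b'
     (Rcoef q be al be' al' * Rcoef q b a b' a') *: h (a', al') (b', be') =
  braidV2 h (b, be) (a, al).
Proof.
transitivity (braidV q (fun be al =>
    braidV q (fun b a => h (b, be) (a, al)) b a) be al); last exact: flip_combC.
rewrite -[RHS]braidV_Rcoef.
apply: eq_bigr => al' _; apply: eq_bigr => be' _.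
rewrite -braidV_Rcoef scaler_sumr; apply: eq_bigr => a' _.
by rewrite scaler_sumr; apply: eq_bigr => b' _; rewrite scalerA.
Qed.

(** The FRT form of the relations: for G a b al be = z_a^al z_b^be the operators
    T on the Latin and on the Greek indices agree. *)
Definition frt V (G : 'I_n -> 'I_n -> 'I_m -> 'I_m -> V) : Prop :=
  forall a b al be, braid q (fun a b => G a b al be) a b = braid q (G a b) al be.

Section Triples.
Variable V : lmodType K.
Implicit Types H : 'I_n -> 'I_n -> 'I_n -> 'I_m -> 'I_m -> 'I_m -> V.

(** T acting on two neighbouring positions of a triple, either of Latin (n) or
    of Greek (m) indices. *)
Definition n12 H i a b io al be := braid q (fun i a => H i a b io al be) i a.
Definition n23 H i a b io al be := braid q (fun a b => H i a b io al be) a b.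
Definition m12 H i a b io al be := braid q (fun io al => H i a b io al be) io al.
Definition m23 H i a b io al be := braid q (fun al be => H i a b io al be) al be.

(** H (i, a, b, io, al, be) stands for z_i^io z_a^al dz_b^be, so that
    T_12 T_23 H is dz_i^io z_a^al z_b^be, with T = T_n T_m.  Moving T_23 from
    the left to the right of T_12 T_23 by the braid relation turns it into
    T_12, which acts on the product of two generators. *)
Lemma braid2_frt (H : 'I_n -> 'I_n -> 'I_n -> 'I_m -> 'I_m -> 'I_m -> V) : q != 0 ->
  n12 H = m12 H ->
  n23 (n12 (m12 (n23 (m23 H)))) = m23 (n12 (m12 (n23 (m23 H)))).
Proof.
move=> q0 nmH.
have nm11 H' : m12 (n12 H') = n12 (m12 H').
  by do 6!apply: funext => ?; exact: flip_combC.
have nm12 H' : m23 (n12 H') = n12 (m23 H').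
  by do 6!apply: funext => ?; exact: flip_combC.
have nm21 H' : m12 (n23 H') = n23 (m12 H').
  by do 6!apply: funext => ?; exact: flip_combC.
have nm22 H' : m23 (n23 H') = n23 (m23 H').
  by do 6!apply: funext => ?; exact: flip_combC.
have nYB H' : n23 (n12 (n23 H')) = n12 (n23 (n12 H')).
  by do 6!apply: funext => ?; rewrite /n12 /n23 braid_braid.
have mYB H' : m23 (m12 (m23 H')) = m12 (m23 (m12 H')).
  by do 6!apply: funext => ?; rewrite /m12 /m23 braid_braid.
by rewrite nm21 nYB nm12 nm22 mYB -nmH nm12 nm11.
Qed.
End Triples.

Section Relations.
Variables (V : lmodType K) (G : 'I_n -> 'I_n -> 'I_m -> 'I_m -> V).

(** The four clauses are the relations of the algebra.  For a = b, al < be the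
    equation reads q G = G' + (q - q^-1) G, that is G = q G'; for a < b the
    cases al < be and al > be give the commutation and the cross relation. *)
Lemma frtP : q != 0 ->
  frt G <->
  [/\ forall a (al be : 'I_m), (al < be)%N -> G a a al be = q *: G a a be al,
      forall (a b : 'I_n) al, (a < b)%N -> G a b al al = q *: G b a al al,
      forall (a b : 'I_n) (al be : 'I_m), (a < b)%N -> (be < al)%N ->
        G a b al be = G b a be al
    & forall (a b : 'I_n) (al be : 'I_m), (a < b)%N -> (al < be)%N ->
        G a b al be = G b a be al + (q - q^-1) *: G a b be al].
Proof.
move=> q0; split=> [fG|[G1 G2 G3 G4] a b al be]; last first.
  rewrite /braid /flip_comb -!val_eqE /=.
  case: (ltngtP a b) => [ab|ab|/val_inj ab];
  case: (ltngtP al be) => [l|l|/val_inj l].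
  - by rewrite (G3 _ _ _ _ ab l); lin_eq K V; ring.
  - by rewrite (G4 _ _ _ _ ab l) (G3 _ _ _ _ ab l); lin_eq K V; ring.
  - by subst be; rewrite (G2 _ _ _ ab); lin_eq K V; field.
  - by rewrite (G4 _ _ _ _ ab l) (G3 _ _ _ _ ab l); lin_eq K V; ring.
  - by rewrite (G3 _ _ _ _ ab l); lin_eq K V; ring.
  - by subst be; rewrite (G2 _ _ _ ab); lin_eq K V; field.
  - by subst b; rewrite (G1 _ _ _ l); lin_eq K V; field.
  - by subst b; rewrite (G1 _ _ _ l); lin_eq K V; field.
  - by subst b be.
split=> [a al be l|a b al l|a b al be ab l|a b al be ab l].
- have := fG a a al be; rewrite /braid /flip_comb eqxx -val_eqE /= l ltn_eqF //.
  set x := G a a al be; set y := G a a be al => e.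
  have {e} -> : y = (q *: x + 0 *: x) - (q - q^-1) *: x.
    by rewrite e; lin_eq K V; ring.
  lin_eq K V; field; exact: q0.
- have := fG a b al al; rewrite /braid /flip_comb eqxx -val_eqE /= l ltn_eqF //.
  set x := G a b al al; set y := G b a al al => e.
  have {e} -> : y = (q *: x + 0 *: x) - (q - q^-1) *: x.
    by rewrite -e; lin_eq K V; ring.
  lin_eq K V; field; exact: q0.
- have := fG a b be al; rewrite /braid /flip_comb -!val_eqE /= ab l.
  rewrite !ltn_eqF // !scale1r.
  by move/addrI.
- have := fG a b be al; rewrite /braid /flip_comb -!val_eqE /= ab.
  rewrite [(be < al)%N]ltnNge (ltnW l) ltn_eqF // gtn_eqF //= !scale1r scale0r add0r.
  by move<-; rewrite addrC.
Qed.
End Relations.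
End PairBraiding.

(** * Representations of presented algebras *)

(** The scalars enter through a central morphism [sc], because the target below,
    matrices over a noncommutative K-algebra, is a module over the coefficient
    ring and not over K. *)
Section Lift.
Variables (K : fieldType) (X : Type) (rel : alg_term K X -> alg_term K X -> Prop).
Variables (B : pzRingType) (sc : {rmorphism K -> B}) (g : X -> B).
Hypothesis scC : forall c b, sc c * b = b * sc c.

Fixpoint alg_eval (t : alg_term K X) : B :=
  match t with
  | AGen x => g x
  | AZero => 0
  | AOne => 1
  | AAdd s t => alg_eval s + alg_eval t
  | AScale c t => sc c * alg_eval t
  | AMul s t => alg_eval s * alg_eval t
  end.

Hypothesis g_rel : forall s t, rel s t -> alg_eval s = alg_eval t.

Lemma alg_eval_cong s t : alg_cong rel s t -> alg_eval s = alg_eval t.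
Proof.
elim=> {s t} //=; try by move=> *; congruence.
- by move=> *; rewrite addrA.
- by move=> *; rewrite addrC.
- by move=> *; rewrite add0r.
- by move=> t; rewrite rmorphN1 mulN1r addNr.
- by move=> *; rewrite mulrA rmorphM.
- by move=> t; rewrite rmorph1 mul1r.
- by move=> *; rewrite mulrDr.
- by move=> *; rewrite rmorphD mulrDl.
- by move=> *; rewrite mulrA.
- by move=> *; rewrite mul1r.
- by move=> *; rewrite mulr1.
- by move=> *; rewrite mulrDl.
- by move=> *; rewrite mulrDr.
- by move=> *; rewrite mulrA.
- by move=> c s t; rewrite !mulrA scC.
Qed.

Definition palg_lift (x : palg rel) : B := alg_eval (repr x).

Lemma palg_liftE t : palg_lift (palg_pi rel t) = alg_eval t.
Proof. exact/alg_eval_cong/palg_repr_cong. Qed.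

Lemma palg_liftD x y : palg_lift (x + y) = palg_lift x + palg_lift y.
Proof.
have [s ->] := palg_ex x; have [t ->] := palg_ex y.
by rewrite /GRing.add /= palg_addE !palg_liftE.
Qed.

Lemma palg_liftM x y : palg_lift (x * y) = palg_lift x * palg_lift y.
Proof.
have [s ->] := palg_ex x; have [t ->] := palg_ex y.
by rewrite /GRing.mul /= palg_mulE !palg_liftE.
Qed.

Lemma palg_lift1 : palg_lift 1 = 1.
Proof. exact: (palg_liftE (AOne K X)). Qed.

Lemma palg_liftZ c x : palg_lift (c *: x) = sc c * palg_lift x.
Proof.
have [s ->] := palg_ex x.
by rewrite /GRing.scale /= palg_scaleE !palg_liftE.
Qed.

Lemma palg_lift_gen x : palg_lift (palg_gen rel x) = g x.
Proof. exact: (palg_liftE (AGen K x)). Qed.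

End Lift.

(** * First-order differentials form a free left module *)

Section Matq.
Variables (K : fieldType) (q : K) (m n : nat).
Local Notation A := (matq q m n).
Local Notation X := ('I_n * 'I_m)%type.
Local Notation z := (@matq_z K q m n).

Lemma matq_mulZl (c : K) (x y : A) : (c *: x) * y = c *: (x * y).
Proof. exact/esym/palg_scaleAl. Qed.

Lemma matq_mulZr (c : K) (x y : A) : x * (c *: y) = c *: (x * y).
Proof. exact/esym/palg_scaleAr. Qed.

Lemma matq_mull_linear (x : A) : linear (fun y : A => x * y).
Proof. by move=> c u v; rewrite mulrDr matq_mulZr. Qed.

Lemma matq_mulr_linear (x : A) : linear (fun y : A => y * x).
Proof. by move=> c u v; rewrite mulrDl matq_mulZl. Qed.

Lemma matq_frt : q != 0 -> frt q (fun a b al be => z a al * z b be).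
Proof.
have zz a al b be : z a al * z b be = palg_pi (@matq_rel K q m n)
    (AMul (AGen K (a, al)) (AGen K (b, be))) by exact: palg_mulE.
have sz c t : c *: (palg_pi (@matq_rel K q m n) t : A) = palg_pi _ (AScale c t).
  exact: palg_scaleE.
have dz s t : (palg_pi (@matq_rel K q m n) s : A) + palg_pi (@matq_rel K q m n) t
   = palg_pi _ (AAdd s t) by exact: palg_addE.
move=> q0; apply/frtP => //; split=> *; rewrite !zz ?sz ?dz;
  apply/palg_piP/acong_rel.
- exact: matq_rel_a.
- exact: matq_rel_alpha.
- exact: matq_rel_comm.
- exact: matq_rel_cross.
Qed.

Local Notation N := #|{: X}|.

(** The row with index w is the expansion of dz_w z_y in the dz_x, so this is
    right multiplication by z_y on the free left module on the dz_x. *)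
Definition right_mx (y : X) : 'M[A]_N :=
  \matrix_(i, j) braid2 q (fun u x : X => if x == enum_val j then z u.1 u.2 else 0)
                   (enum_val i) y.

Lemma right_mxM y y' (i j : 'I_N) : (right_mx y * right_mx y') i j =
  braid2 q (fun u x => braid2 q (fun u' x' =>
     if x' == enum_val j then z u.1 u.2 * z u'.1 u'.2 else 0) x y') (enum_val i) y.
Proof.
rewrite mxE.
under eq_bigr do rewrite !mxE
   (braid2_linear _ _ _ _ (@matq_mulr_linear _)).
rewrite braid2_sum; apply: eq_braid2 => u x.
rewrite (bigD1 (enum_rank x)) //= enum_rankK eqxx big1 ?addr0 => [|k kx].
  rewrite (braid2_linear _ _ _ _ (@matq_mull_linear _)).
  by apply: eq_braid2 => u' x'; case: ifP; rewrite ?mulr0.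
by rewrite ifN ?mul0r //; apply: contra kx => /eqP->; rewrite enum_valK.
Qed.

(** Together with [frtP] this lets the algebra act from the right. *)
Lemma right_mx_frt i j : q != 0 ->
  frt q (fun a b al be => (right_mx (a, al) * right_mx (b, be)) i j).
Proof.
move=> q0.
(* The coordinate of z_i^io z_a^al dz_b^be at the index of column j. *)
pose H i a b io al be : A :=
  if (b, be) == enum_val j then z i io * z a al else 0.
have nmH : n12 q H = m12 q H.
  apply: funext => i'; apply: funext => a'; apply: funext => b'.
  apply: funext => io'; apply: funext => al'; apply: funext => be'.
  rewrite /n12 /m12 /H; case: (_ == enum_val j); first exact: matq_frt.
  by rewrite /braid /flip_comb !scaler0.
pose F := n12 q (m12 q (n23 q (m23 q H))).
have FE : (fun a b al be => (right_mx (a, al) * right_mx (b, be)) i j) =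
    fun a b al be => F (enum_val i).1 a b (enum_val i).2 al be.
  by do 4![apply: funext => ?]; rewrite right_mxM.
rewrite FE => a b al be.
exact: (congr1 (fun F => F (enum_val i).1 a b (enum_val i).2 al be)
  (braid2_frt q0 nmH)).
Qed.

Definition scalar_mx_matq (c : K) : 'M[A]_N := (c *: (1 : A))%:M.

Fact scalar_mx_matq_additive : additive scalar_mx_matq.
Proof. by move=> c e; rewrite /scalar_mx_matq scalerBl raddfB. Qed.

Fact scalar_mx_matq_monoid : monoid_morphism scalar_mx_matq.
Proof.
split=> [|c e]; first by rewrite /scalar_mx_matq scale1r.
by rewrite /scalar_mx_matq -[RHS]/(_ *m _) -scalar_mxM matq_mulZl mul1r scalerA.
Qed.

HB.instance Definition _ := GRing.isZmodMorphism.Build K 'M[A]_N scalar_mx_matq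
  scalar_mx_matq_additive.
HB.instance Definition _ := GRing.isMonoidMorphism.Build K 'M[A]_N scalar_mx_matq
  scalar_mx_matq_monoid.

Lemma scalar_mx_matqE c M i j : (scalar_mx_matq c * M) i j = c *: M i j.
Proof.
by rewrite [LHS]/= [scalar_mx_matq c * M]mul_scalar_mx mxE matq_mulZl mul1r.
Qed.

Lemma scalar_mx_matqC c M : scalar_mx_matq c * M = M * scalar_mx_matq c.
Proof.
apply/matrixP => i j; rewrite scalar_mx_matqE mxE (bigD1 j) //= big1 => [|k kj].
  by rewrite addr0 mxE eqxx mulr1n matq_mulZr mulr1.
by rewrite mxE (negPf kj) mulr0n mulr0.
Qed.

Lemma right_mx_rel s t : q != 0 -> matq_rel q s t ->
  alg_eval scalar_mx_matq right_mx s = alg_eval scalar_mx_matq right_mx t.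
Proof.
move=> q0 st; apply/matrixP => i j.
have [r1 r2 r3 r4] := (frtP _ q0).1 (right_mx_frt i j q0).
case: st => /= *;
  rewrite ?scalar_mx_matqE ?[(_ + _ : 'M_N) _ _]mxE ?scalar_mx_matqE.
- exact: r1.
- exact: r2.
- exact: r3.
- exact: r4.
Qed.

Definition right_act : A -> 'M[A]_N :=
  palg_lift (rel := @matq_rel K q m n) scalar_mx_matq right_mx.

Local Notation term := (bim_term (@matq_rel K q m n) X).

(** The free model of the bimodule: left multiplication is entrywise, right
    multiplication goes through [right_act]. *)
Fixpoint row_eval (t : term) : 'rV[A]_N :=
  match t with
  | BGen x => delta_mx 0 (enum_rank x)
  | BZero => 0
  | BAdd s t => row_eval s + row_eval t
  | Defs.BLeft a t => a *: row_eval t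
  | Defs.BRight t a => row_eval t *m right_act a
  end.

Lemma row_eval_BSum (I : finType) (t : I -> term) :
  row_eval (BSum t) = \sum_i row_eval (t i).
Proof. exact: big_morph. Qed.

Hypothesis q0 : q != 0.
Let rels := fun s t => @right_mx_rel s t q0.

(** In the model dz_w z_y was defined by T, and the relations apply T^-1. *)
Lemma row_eval_rel s t : omega1_rel s t -> row_eval s = row_eval t.
Proof.
case=> a b al be; apply/rowP => j /=.
have entry y w k : (delta_mx 0 (enum_rank w) *m right_mx y : 'rV[A]_N) 0 k =
    right_mx y (enum_rank w) k by rewrite -rowE mxE.
have genE y : right_act (z y.1 y.2) = right_mx y.
  rewrite /right_act /matq_z -surjective_pairing.
  apply: palg_lift_gen rels _. exact: scalar_mx_matqC.
rewrite row_eval_BSum summxE.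
under eq_bigr => al' _.
  rewrite row_eval_BSum summxE.
  under eq_bigr => be' _.
    rewrite row_eval_BSum summxE.
    under eq_bigr => a' _.
      rewrite row_eval_BSum summxE.
      under eq_bigr => b' _.
        rewrite /= mxE (genE (b', be')) entry matq_mulZl mul1r.
        over.
      over.
    over.
  over.
pose h u x : A := if x == enum_val j then z u.1 u.2 else 0.
transitivity (braidV2 q (fun w y => braid2 q h w y) (b, be) (a, al)).
  rewrite braidV2K // /h !mxE eqxx /= -(inj_eq enum_val_inj) enum_rankK eq_sym.
  by case: eqP => _; rewrite ?mulr1 ?mulr0.
rewrite -braidV2_Rcoef; do 4![apply: eq_bigr => ? _].
by rewrite mxE enum_rankK.
Qed.

Lemma row_eval_cong s t :
  bim_cong (@omega1_rel K q m n) s t -> row_eval s = row_eval t.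
Proof.
have raD := palg_liftD scalar_mx_matqC rels.
have raM := palg_liftM scalar_mx_matqC rels.
have ra1 := palg_lift1 scalar_mx_matqC rels.
have raZ := palg_liftZ scalar_mx_matqC rels.
elim=> {s t} /=; try by move=> *; congruence.
- exact: row_eval_rel.
- by move=> *; rewrite addrA.
- by move=> *; rewrite addrC.
- by move=> *; rewrite add0r.
- by move=> t; rewrite scaleN1r addNr.
- by move=> *; rewrite scalerA.
- by move=> t; rewrite scale1r.
- by move=> *; rewrite scalerDr.
- by move=> *; rewrite scalerDl.
- by move=> a b t; rewrite -mulmxA [right_act (a * b)]raM.
- by move=> t; rewrite [right_act 1]ra1 mulmx1.
- by move=> *; rewrite mulmxDl.
- by move=> a b t; rewrite [right_act (a + b)]raD mulmxDr.
- by move=> a b t; rewrite scalemxAl.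
- move=> c t; rewrite [right_act _]raZ ra1 mulr1 /scalar_mx_matq.
  apply/rowP => j; rewrite !mxE (bigD1 j) //= big1 => [|k kj].
    by rewrite addr0 mxE eqxx mulr1n matq_mulZr matq_mulZl mul1r mulr1.
  by rewrite mxE (negPf kj) mulr0n mulr0.
Qed.

(** The existence of these left linear coordinates, dual to the dz_x, is what
    freeness of the left module of differentials amounts to. *)
Definition dz_coord (x : X) (w : omega1 q m n) : A :=
  row_eval (repr w) 0 (enum_rank x).

Lemma dz_coordE x t :
  dz_coord x (pbim_pi (@omega1_rel K q m n) t) = row_eval t 0 (enum_rank x).
Proof. by rewrite /dz_coord (row_eval_cong (pbim_repr_cong _ t)). Qed.

Lemma dz_coordD x u v : dz_coord x (u + v) = dz_coord x u + dz_coord x v.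
Proof.
have [s ->] := pbim_ex u; have [t ->] := pbim_ex v.
have -> : (pbim_pi (@omega1_rel K q m n) s : omega1 q m n) +
    pbim_pi (@omega1_rel K q m n) t = pbim_pi _ (BAdd s t).
  exact: pbim_addE.
by rewrite !dz_coordE /= mxE.
Qed.

Lemma dz_coord_lact x f w : dz_coord x (lact f w) = f * dz_coord x w.
Proof.
have [t ->] := pbim_ex w; rewrite pbim_lactE !dz_coordE /=.
by rewrite mxE.
Qed.

Lemma dz_coordZ x c w : dz_coord x (c *: w) = c *: dz_coord x w.
Proof. by rewrite -[c *: w]lact_scalar dz_coord_lact matq_mulZl mul1r. Qed.

Lemma dz_coord_dz x a al : dz_coord x (dz q a al) = ((a, al) == x)%:R.
Proof.
rewrite /dz /pbim_gen dz_coordE /= mxE eqxx /= (inj_eq enum_rank_inj) eq_sym.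
by [].
Qed.

End Matq.

(** * Raising operators on pairs of indices *)

Lemma braid_raise_tensorC (K : fieldType) (q r : K) (k l : nat)
    (V : lmodType K) (i0 i1 : 'I_l)
    (h : 'I_k -> 'I_k -> 'I_l -> 'I_l -> V) a b c d :
  braid q (fun a b => raise_tensor q r i0 i1 (h a b) c d) a b =
  raise_tensor q r i0 i1 (fun c d => braid q (fun a b => h a b c d) a b) c d.
Proof.
rewrite /braid /flip_comb /raise_tensor /raise; move: r^-1 => s.
by do 2![case: (_ == i1)]; lin_eq K V; ring.
Qed.

Lemma raise_linear (K : fieldType) (r : K) (k : nat) (V W : lmodType K)
    (i0 i1 : 'I_k) (f : V -> W) (h : 'I_k -> V) a : linear f ->
  f (raise r i0 i1 h a) = raise r i0 i1 (fun a => f (h a)) a.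
Proof.
by move=> lf; rewrite /raise; case: ifP; rewrite ?(linear_atZ lf) ?(linear_at0 lf).
Qed.

Section PairRaising.
Variables (K : fieldType) (q r : K) (n m : nat).
Local Notation X := ('I_n * 'I_m)%type.
Implicit Types s : 'I_n * 'I_n + 'I_m * 'I_m.

Definition adjacent s : Prop :=
  match s with
  | inl i => i.2 = i.1.+1 :> nat
  | inr i => i.2 = i.1.+1 :> nat
  end.

(** The index s picks the tensor factor on which a generator acts: [inl] for the
    Latin and [inr] for the Greek indices, with the pair (i0, i1) of adjacent
    indices involved.  [lowerX] is the transpose of [raiseX], hence the
    coefficient r^-1 in both. *)
Definition raiseX s (V : lmodType K) (h : X -> V) (x : X) : V :=
  match s with
  | inl i => raise r i.1 i.2 (fun a => h (a, x.2)) x.1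
  | inr i => raise r i.1 i.2 (fun al => h (x.1, al)) x.2
  end.

Definition lowerX s (V : lmodType K) (h : X -> V) (x : X) : V :=
  match s with
  | inl i => raise r i.2 i.1 (fun a => h (a, x.2)) x.1
  | inr i => raise r i.2 i.1 (fun al => h (x.1, al)) x.2
  end.

Definition weightX s (x : X) : K :=
  match s with
  | inl i => weight q i.1 i.2 x.1
  | inr i => weight q i.1 i.2 x.2
  end.

Definition weight_fst s (a : 'I_n) : K :=
  if s is inl i then weight q i.1 i.2 a else 1.

Definition weight_snd s (al : 'I_m) : K :=
  if s is inr i then weight q i.1 i.2 al else 1.

Lemma weightXE s x : weightX s x = weight_fst s x.1 * weight_snd s x.2.
Proof. by case: s => i; rewrite /= ?mulr1 ?mul1r. Qed.

Definition raiseX_tensor s (V : lmodType K) (h : X -> X -> V) (w y : X) : V :=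
  raiseX s (h^~ y) w + weightX s w *: raiseX s (h w) y.

Lemma raiseX_linear s (V W : lmodType K) (f : V -> W) (h : X -> V) x : linear f ->
  f (raiseX s h x) = raiseX s (fun x => f (h x)) x.
Proof. by case: s => i lf; apply: raise_linear. Qed.

(** On the factor where E acts this is [braid_raise_tensor]; on the other factor
    the two operators act on different indices. *)
Lemma braid2_raiseX_tensor s (V : lmodType K) (h : X -> X -> V) w y :
  q != 0 -> adjacent s ->
  braid2 q (raiseX_tensor s h) w y = raiseX_tensor s (braid2 q h) w y.
Proof.
move: w y => [a al] [b be] q0; case: s => i /= adj.
- transitivity (braid q (raise_tensor q r i.1 i.2 (fun a b =>
      braid q (fun al be => h (a, al) (b, be)) al be)) a b).
    rewrite {1}/braid2 /=; congr (_ a b); congr braid; do 2![apply: funext => ?].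
    exact: braid_raise_tensorC.
  exact: braid_raise_tensor.
transitivity (braid q (fun a b => raise_tensor q r i.1 i.2
    (braid q (fun al be => h (a, al) (b, be))) al be) a b).
  rewrite {1}/braid2 /=; congr (_ a b); congr braid; do 2![apply: funext => ?].
  exact: braid_raise_tensor.
exact: braid_raise_tensorC.
Qed.

(** T only permutes the indices, so it preserves every multiplicative weight. *)
Lemma braid2_diag (k1 : 'I_n -> K) (k2 : 'I_m -> K) (V : lmodType K)
    (h : X -> X -> V) w y :
  braid2 q (fun u x => (k1 u.1 * k2 u.2 * (k1 x.1 * k2 x.2)) *: h u x) w y =
  (k1 w.1 * k2 w.2 * (k1 y.1 * k2 y.2)) *: braid2 q h w y.
Proof.
by move: w y => [a al] [b be]; rewrite /braid2 /braid /flip_comb /=; lin_eq K V; ring.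
Qed.

Lemma braid2D (V : lmodType K) (h h' : X -> X -> V) w y :
  braid2 q (fun u x => h u x + h' u x) w y = braid2 q h w y + braid2 q h' w y.
Proof.
by move: w y => [a al] [b be]; rewrite /braid2 /braid /flip_comb /=; lin_eq K V; ring.
Qed.

End PairRaising.

(** * Covariance of the differential *)

Lemma matq_ind (K : fieldType) (q : K) (m n : nat) (P : matq q m n -> Prop) :
  P 1 -> (forall c f g, P f -> P g -> P (c *: f + g)) ->
  (forall f a al, P f -> P (f * matq_z q a al)) -> forall f, P f.
Proof.
move=> P1 Plin Pz.
have P0 : P 0 by rewrite -(addNr 1) -scaleN1r; apply: Plin.
have PD f g : P f -> P g -> P (f + g) by rewrite -{2}[f]scale1r; apply: Plin.
have PZ c f : P f -> P (c *: f) by move=> Pf; rewrite -[_ *: _]addr0; apply: Plin.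
suff PM g f : P f -> P (f * g) by move=> f; rewrite -[f]mul1r; apply: PM.
have [t ->] := palg_ex g.
elim: t f => [[a al]|||s IHs t IHt|c t IHt|s IHs t IHt] f Pf.
- exact: Pz.
- by rewrite [palg_pi _ _]/(0 : matq q m n) mulr0.
- by rewrite [palg_pi _ _]/(1 : matq q m n) mulr1.
- rewrite -palg_addE [palg_add _ _]/((_ : matq q m n) + _) mulrDr; apply: PD; auto.
- rewrite -palg_scaleE [palg_scale _ _]/(_ *: (_ : matq q m n)) matq_mulZr.
  by apply: PZ; auto.
- rewrite -palg_mulE [palg_mul _ _]/((_ : matq q m n) * _) mulrA; auto.
Qed.

Section Covariance.
Variables (K : fieldType) (q r : K) (m n : nat).
Hypothesis q0 : q != 0.
Local Notation A := (matq q m n).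
Local Notation X := ('I_n * 'I_m)%type.
Local Notation Omega := (omega1 q m n).
Let z (x : X) : A := matq_z q x.1 x.2.
Let dzX (x : X) : Omega := dz q x.1 x.2.

Local Notation pi := (pbim_pi (@omega1_rel K q m n) : _ -> Omega).

Lemma pbim_pi_BSum (I : finType) t : pi (BSum t) = \sum_(i : I) pi (t i).
Proof. by apply: (big_morph pi) => // s t'; rewrite -[LHS]pbim_addE. Qed.

(** The defining relations solved for dz_w z_y. *)
Lemma ract_dz (w y : X) :
  ract (dzX w) (z y) = braid2 q (fun u x => lact (z u) (dzX x)) w y.
Proof.
move: w y => w y; rewrite -(braid2K (fun w y => ract (dzX w) (z y)) w y q0).
apply: eq_braid2 => -[b be] [a al].
rewrite -braidV2_Rcoef /z /dzX /dz /= pbim_lactE.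
rewrite ((pbim_piP _ _ _).2 (bcong_rel (omega1_rel_z q a b al be))).
rewrite pbim_pi_BSum; apply: eq_bigr => al' _.
rewrite pbim_pi_BSum; apply: eq_bigr => be' _.
rewrite pbim_pi_BSum; apply: eq_bigr => a' _.
rewrite pbim_pi_BSum; apply: eq_bigr => b' _.
by rewrite pbim_ractE -lact_scalar pbim_lactE.
Qed.

Lemma lact_linear f : linear (lact f : Omega -> Omega).
Proof.
move=> c u v.
by rewrite lactDr -!lact_scalar !lactA matq_mulZr matq_mulZl mulr1 mul1r.
Qed.

Lemma lact_linearl w : linear (fun f : A => lact f w : Omega).
Proof. by move=> c f g; rewrite lactDl -!lact_scalar !lactA matq_mulZl mul1r. Qed.

Lemma ract_linear f : linear (fun w : Omega => ract w f).
Proof. by move=> c u v; rewrite ractDl -!lact_scalar lact_ract. Qed.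

Lemma ract_linearr w : linear (fun f : A => ract w f : Omega).
Proof. by move=> c f g; rewrite ractDr -ract_scalar ractA matq_mulZr mulr1. Qed.

Variables (d : A -> Omega) (pd : 'I_n -> 'I_m -> A -> A).
Hypotheses (hd : is_differential d) (hpd : are_partials d pd).

Lemma d_1 : d 1 = 0.
Proof.
have [_ _ dM] := hd; have := dM 1 1; rewrite mulr1 ract1 lact1.
by move/(congr1 (fun u => u - d 1)); rewrite subrr addrK.
Qed.

Lemma dfE f : d f = \sum_x lact (pd x.1 x.2 f) (dzX x).
Proof. by rewrite hpd pair_big. Qed.

Lemma dz_coord_dzX (x w : X) : dz_coord x (dzX w) = (w == x)%:R.
Proof. by rewrite /dzX dz_coord_dz // -surjective_pairing. Qed.

Lemma dz_coord_linear x : linear (@dz_coord K q m n x).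
Proof. by move=> c u v; rewrite dz_coordD // dz_coordZ. Qed.

Lemma sum_dz_coord (B : zmodType) x (F : X -> A -> B) g :
  (forall x, F x 0 = 0) -> \sum_w F w (dz_coord w (lact g (dzX x))) = F x g.
Proof.
move=> F0; rewrite (bigD1 x) //= big1 => [|w wx].
  by rewrite dz_coord_lact // dz_coord_dzX eqxx mulr1 addr0.
by rewrite dz_coord_lact // dz_coord_dzX eq_sym (negPf wx) mulr0 F0.
Qed.

Lemma dz_coord_lact_dz x w g :
  dz_coord x (lact g (dzX w)) = if w == x then g else 0.
Proof. by rewrite dz_coord_lact // dz_coord_dzX; case: eqP; rewrite ?mulr1 ?mulr0. Qed.

Lemma dz_coord_d x f : dz_coord x (d f) = pd x.1 x.2 f.
Proof.
rewrite dfE (linear_at_sum (dz_coord_linear x)) (bigD1 x) //= big1 => [|w wx].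
  by rewrite dz_coord_lact_dz eqxx addr0.
by rewrite dz_coord_lact_dz (negPf wx).
Qed.

(** The differential of f is a combination of the dz_w, so linear maps are
    compared on d f by testing them on the g dz_w. *)
Lemma eq_on_differentials (V : lmodType K) (F G : Omega -> V) f :
  linear F -> linear G ->
  (forall g w, F (lact g (dzX w)) = G (lact g (dzX w))) -> F (d f) = G (d f).
Proof.
move=> lF lG FG; rewrite dfE.
by rewrite !linear_at_sum //; apply: eq_bigr => w _.
Qed.

Lemma d_linear : linear d. Proof. by case: hd. Qed.

Lemma d_mulz f y : d (f * z y) = ract (d f) (z y) + lact f (dzX y).
Proof. by have [_ dz1 dM] := hd; rewrite dM dz1. Qed.

Lemma ract_lact_dz f (w y : X) :
  ract (lact f (dzX w)) (z y) =
  lact f (braid2 q (fun u x => lact (z u) (dzX x)) w y).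
Proof. by rewrite lact_ract ract_dz. Qed.

(** A grouplike element, acting on z_x by a weight that is a product of a
    function of the Latin and one of the Greek index. *)
Section Diagonal.
Variables (k : A -> A) (k1 : 'I_n -> K) (k2 : 'I_m -> K).
Hypotheses (k_lin : linear k) (k_1 : k 1 = 1).
Hypotheses (k_M : forall f g, k (f * g) = k f * k g).
Let kap (x : X) := k1 x.1 * k2 x.2.
Hypothesis k_z : forall x, k (z x) = kap x *: z x.

(** The action on differentials, k (f dz_x) = kap_x (k f) dz_x. *)
Definition diag_omega (w : Omega) : Omega :=
  \sum_x kap x *: lact (k (dz_coord x w)) (dzX x).

Lemma diag_omega_linear : linear diag_omega.
Proof.
move=> c u v; rewrite /diag_omega scaler_sumr -big_split /=; apply: eq_bigr => x _.
by rewrite dz_coord_linear k_lin lact_linearl scalerDr !scalerA mulrC.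
Qed.

Lemma diag_omega_lact_dz g x :
  diag_omega (lact g (dzX x)) = kap x *: lact (k g) (dzX x).
Proof.
rewrite /diag_omega (@sum_dz_coord _ x (fun x g => kap x *: lact (k g) (dzX x))) //.
by move=> y; rewrite (linear_at0 k_lin) (linear_at0 (lact_linearl _)) scaler0.
Qed.

Lemma diag_omega_ract g w y :
  diag_omega (ract (lact g (dzX w)) (z y)) =
  ract (diag_omega (lact g (dzX w))) (k (z y)).
Proof.
rewrite ract_lact_dz diag_omega_lact_dz k_z.
rewrite (linear_atZ (ract_linearr _)) (linear_atZ (ract_linear _)) ract_lact_dz.
have lF : linear (fun w => diag_omega (lact g w)).
  by move=> c u v; rewrite lact_linear diag_omega_linear.
have lG := lact_linear (k g).
rewrite (braid2_linear _ _ _ _ lF) (braid2_linear _ _ _ _ lG) scalerA mulrC.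
rewrite -(braid2_diag q k1 k2); apply: eq_braid2 => u x.
rewrite lactA diag_omega_lact_dz k_M k_z matq_mulZr.
by rewrite (linear_atZ (lact_linearl _)) scalerA -lactA [_ * kap u]mulrC.
Qed.

Lemma d_diag f : d (k f) = diag_omega (d f).
Proof.
elim/matq_ind: f => [|c f g IHf IHg|f a al IH].
- by rewrite k_1 d_1 (linear_at0 diag_omega_linear).
- by rewrite k_lin !d_linear diag_omega_linear IHf IHg.
pose y : X := (a, al); rewrite -/(z y) k_M d_mulz (linear_atD diag_omega_linear).
have [_ dz1 dM] := hd; rewrite dM IH; congr (_ + _); last first.
  rewrite diag_omega_lact_dz k_z (linear_atZ d_linear) (linear_atZ (lact_linear _)).
  by rewrite dz1.
symmetry; apply: (@eq_on_differentials _ (fun w => diag_omega (ract w (z y)))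
  (fun w => ract (diag_omega w) (k (z y)))) => [c u v|c u v|g w].
- by rewrite ract_linear diag_omega_linear.
- by rewrite diag_omega_linear ract_linear.
exact: diag_omega_ract.
Qed.

Lemma pd_diag x f : pd x.1 x.2 (k f) = kap x *: k (pd x.1 x.2 f).
Proof.
rewrite -!dz_coord_d d_diag dfE !(linear_at_sum diag_omega_linear).
rewrite !(linear_at_sum (dz_coord_linear x)) (linear_at_sum k_lin) scaler_sumr.
apply: eq_bigr => w _; rewrite diag_omega_lact_dz dz_coordZ // !dz_coord_lact_dz.
by case: eqP => [->//|_]; rewrite (linear_at0 k_lin) !scaler0.
Qed.
End Diagonal.

(** Here e and k are the actions of E_s and K_s. *)
Section Raising.
Variables (s : 'I_n * 'I_n + 'I_m * 'I_m) (e k : A -> A).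
Hypotheses (adj : adjacent s) (e_lin : linear e) (k_lin : linear k).
Hypotheses (e_1 : e 1 = 0) (k_1 : k 1 = 1).
Hypotheses (e_M : forall f g, e (f * g) = e f * g + k f * e g).
Hypotheses (k_M : forall f g, k (f * g) = k f * k g).
Hypotheses (e_z : forall x, e (z x) = raiseX r s z x).
Hypotheses (k_z : forall x, k (z x) = weightX q s x *: z x).

(** The action on differentials, e (f dz_x) = (e f) dz_x + (k f) (e dz_x). *)
Definition raise_omega (w : Omega) : Omega :=
  \sum_x (lact (e (dz_coord x w)) (dzX x) +
          lact (k (dz_coord x w)) (raiseX r s dzX x)).

Lemma raise_omega_linear : linear raise_omega.
Proof.
move=> c u v; rewrite /raise_omega scaler_sumr -big_split /=; apply: eq_bigr => x _.
by rewrite dz_coord_linear e_lin k_lin !lact_linearl scalerDr addrACA.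
Qed.

Lemma raise_omega_lact_dz g x :
  raise_omega (lact g (dzX x)) = lact (e g) (dzX x) + lact (k g) (raiseX r s dzX x).
Proof.
rewrite /raise_omega (@sum_dz_coord _ x (fun x g =>
  lact (e g) (dzX x) + lact (k g) (raiseX r s dzX x))) //.
move=> y; rewrite (linear_at0 e_lin) (linear_at0 k_lin).
by rewrite !(linear_at0 (lact_linearl _)) addr0.
Qed.

Let k1 := weight_fst q s.
Let k2 := weight_snd q s.

Let k_z' x : k (z x) = (k1 x.1 * k2 x.2) *: z x.
Proof. by rewrite k_z weightXE. Qed.

(** The action on differentials is compatible with right multiplication by z_y.
    After dz_w z_y is rewritten through T this is [braid2_raiseX_tensor]. *)
Lemma raise_omega_ract g w y :
  raise_omega (ract (lact g (dzX w)) (z y)) =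
  ract (raise_omega (lact g (dzX w))) (z y) +
  ract (diag_omega k k1 k2 (lact g (dzX w))) (e (z y)).
Proof.
pose h u x := lact (z u) (dzX x).
have hE : forall w y, ract (dzX w) (z y) = braid2 q h w y := ract_dz.
have lF : linear (fun w => raise_omega (lact g w)).
  by move=> c u v; rewrite lact_linear raise_omega_linear.
rewrite ract_lact_dz (braid2_linear _ _ _ _ lF).
transitivity (braid2 q (fun u x =>
    lact (e g) (h u x) + lact (k g) (raiseX_tensor q r s h u x)) w y).
  apply: eq_braid2 => u x; rewrite lactA raise_omega_lact_dz e_M k_M lactDl -!lactA.
  rewrite -addrA -lactDr e_z k_z; congr (_ + lact _ (_ + _)).
    by rewrite (raiseX_linear _ _ _ _ (lact_linearl _)).
  rewrite (linear_atZ (lact_linearl _)).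
  by rewrite (raiseX_linear _ _ _ _ (lact_linear _)).
rewrite braid2D -!(braid2_linear _ _ _ _ (lact_linear _)) braid2_raiseX_tensor //.
rewrite raise_omega_lact_dz diag_omega_lact_dz // -weightXE ractDl !lact_ract -hE.
rewrite -addrA; congr (_ + _).
rewrite lact_scalar -(linear_atZ (lact_linear _)) -lactDr.
rewrite /raiseX_tensor e_z (raiseX_linear _ _ _ _ (ract_linear _)).
rewrite (raiseX_linear _ _ _ _ (ract_linearr _)).
have -> : (braid2 q h)^~ y = fun x => ract (dzX x) (z y).
  by apply: funext => x; rewrite hE.
suff -> : braid2 q h w = fun x => ract (dzX w) (z x) by [].
by apply: funext => x; rewrite hE.
Qed.

Lemma d_raise f : d (e f) = raise_omega (d f).
Proof.
elim/matq_ind: f => [|c f g IHf IHg|f a al IH].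
- by rewrite e_1 d_1 (linear_at0 d_linear) (linear_at0 raise_omega_linear).
- by rewrite e_lin !d_linear raise_omega_linear IHf IHg.
pose y : X := (a, al); rewrite -/(z y) e_M d_mulz (linear_atD raise_omega_linear).
have [_ dz1 dM] := hd; rewrite (linear_atD d_linear) d_mulz dM IH.
rewrite (d_diag k_lin k_1 k_M k_z') raise_omega_lact_dz addrACA.
congr (_ + (_ + _)); last first.
  rewrite e_z (raiseX_linear _ _ _ _ d_linear).
  by congr (lact _ (raiseX _ _ _ _)); apply: funext => x; rewrite dz1.
symmetry; apply: (@eq_on_differentials _ (fun w => raise_omega (ract w (z y)))
  (fun w => ract (raise_omega w) (z y) +
     ract (diag_omega k k1 k2 w) (e (z y)))) => [c u v|c u v|g w].
- by rewrite ract_linear raise_omega_linear.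
- rewrite raise_omega_linear diag_omega_linear // !ract_linear scalerDr.
  by rewrite addrACA.
exact: raise_omega_ract.
Qed.

(** The transpose appears because coordinates are dual to the dz_x. *)
Lemma sum_raiseX x (g : X -> A) :
  \sum_w dz_coord x (lact (g w) (raiseX r s dzX w)) = lowerX r s g x.
Proof.
have -> : \sum_w dz_coord x (lact (g w) (raiseX r s dzX w)) =
    \sum_w raiseX r s (fun y => if y == x then g w else 0) w.
  apply: eq_bigr => w _; rewrite (raiseX_linear _ _ _ _ (lact_linear _)).
  rewrite (raiseX_linear _ _ _ _ (dz_coord_linear x)).
  by congr raiseX; apply: funext => y; rewrite dz_coord_lact_dz.
rewrite /raiseX /lowerX /raise; case: s => i; case: x => [a al] /=.
  rewrite (bigD1 (i.2, al)) //= big1 => [|[b be] ne] /=.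
    rewrite eqxx addr0 xpair_eqE eqxx andbT eq_sym; case: eqP => // _.
    by rewrite scaler0.
  case: eqP => // eb; rewrite xpair_eqE; case: eqP => [_|_]; last by rewrite scaler0.
  by case: eqP => [eal|_]; [rewrite eb eal eqxx in ne | rewrite scaler0].
rewrite (bigD1 (a, i.2)) //= big1 => [|[b be] ne] /=.
  rewrite eqxx addr0 xpair_eqE eqxx eq_sym; case: eqP => // _.
  by rewrite scaler0.
case: eqP => // ebe; rewrite xpair_eqE; case: eqP => [eb|_]; last by rewrite scaler0.
by rewrite eb ebe eqxx in ne.
Qed.

Lemma pd_raise x f : pd x.1 x.2 (e f) =
  e (pd x.1 x.2 f) + lowerX r s (fun w => k (pd w.1 w.2 f)) x.
Proof.
rewrite -!dz_coord_d d_raise dfE (linear_at_sum raise_omega_linear).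
rewrite !(linear_at_sum (dz_coord_linear x)) (linear_at_sum e_lin).
rewrite -sum_raiseX -big_split.
apply: eq_bigr => w _; rewrite raise_omega_lact_dz dz_coordD // !dz_coord_lact_dz /=.
by congr (_ + _); case: eqP => //; rewrite (linear_at0 e_lin).
Qed.
End Raising.
End Covariance.

(** * Adjoints for the Fock form *)

Section FockForm.
Variables (C : numClosedFieldType) (q r : C) (m n : nat).
Hypotheses (q0 : q != 0) (r_real : Num.conj r = r).
Local Notation A := (matq q m n).
Local Notation X := ('I_n * 'I_m)%type.
Local Notation Omega := (omega1 q m n).
Let z (x : X) : A := matq_z q x.1 x.2.
Variables (d : A -> Omega) (pd : 'I_n -> 'I_m -> A -> A).
Hypotheses (hd : is_differential d) (hpd : are_partials d pd).
Variable form : {dot A for (@Num.conj C)}.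
Hypothesis hform : is_fock_form pd form.

Lemma form_mulz P Q x : form P (Q * z x) = form (pd x.1 x.2 P) Q.
Proof. by rewrite hform.2. Qed.

Lemma form_hermitian P Q : form P Q = Num.conj (form Q P).
Proof. by rewrite hermC expr0 mul1r. Qed.

Lemma form_mulz_1 P x : form (P * z x) 1 = 0.
Proof.
rewrite form_hermitian form_mulz -(dz_coord_d q0 hpd) (d_1 hd).
by rewrite (linear_at0 (dz_coord_linear q0 x)) linear0l conjC0.
Qed.

Section Diagonal.
Variables (k : A -> A) (k1 : 'I_n -> C) (k2 : 'I_m -> C).
Hypotheses (k_lin : linear k) (k_1 : k 1 = 1).
Hypotheses (k_M : forall f g, k (f * g) = k f * k g).
Let kap (x : X) := k1 x.1 * k2 x.2.
Hypothesis k_z : forall x, k (z x) = kap x *: z x.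
Hypothesis kap_real : forall x, Num.conj (kap x) = kap x.

(** Induction on Q through (k P, Q z_x) = (d_x (k P), Q) = kap_x (k (d_x P), Q);
    at Q = 1 only the constant term of P matters, and k fixes it. *)
Lemma form_diag P Q : form (k P) Q = form P (k Q).
Proof.
elim/matq_ind: Q P => [P|c Q Q' IH IH' P|Q a al IH P].
- rewrite k_1; elim/matq_ind: P => [|c P P' IH IH'|P a al _].
  + by rewrite k_1.
  + by rewrite k_lin !linearDl /= !linearZl_LR /= IH IH'.
  rewrite (form_mulz_1 P (a, al)) k_M (k_z (a, al)) matq_mulZr linearZl_LR /=.
  by rewrite form_mulz_1 mulr0.
- by rewrite k_lin !linearDr /= !linearZr_LR /= IH IH'.
pose x : X := (a, al); rewrite -/(z x) form_mulz k_M k_z matq_mulZr.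
rewrite (pd_diag q0 hd hpd k_lin k_1 k_M k_z) linearZl_LR linearZr_LR /=.
by rewrite IH form_mulz kap_real.
Qed.
End Diagonal.

(** Here e, k and l are the actions of E_s, K_s and K_s F_s = E_s^*. *)
Section Raising.
Variables (s : 'I_n * 'I_n + 'I_m * 'I_m) (e k l : A -> A).
Hypotheses (adj : adjacent s).
Hypotheses (e_lin : linear e) (k_lin : linear k) (l_lin : linear l).
Hypotheses (e_1 : e 1 = 0) (k_1 : k 1 = 1) (l_1 : l 1 = 0).
Hypotheses (e_M : forall f g, e (f * g) = e f * g + k f * e g).
Hypotheses (k_M : forall f g, k (f * g) = k f * k g).
Hypotheses (l_M : forall f g, l (f * g) = l f * g + k f * l g).
Hypotheses (e_z : forall x, e (z x) = raiseX r s z x).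
Hypotheses (k_z : forall x, k (z x) = weightX q s x *: z x).
Hypotheses (l_z : forall x, l (z x) = lowerX r s z x).
Hypothesis k_sym : forall P Q, form (k P) Q = form P (k Q).

(** Induction on Q.  In (e P, Q z_x) = (d_x (e P), Q) the term e (d_x P) is
    handled by the induction hypothesis and yields (P, (l Q) z_x); the remaining
    term yields (P, (k Q) (l z_x)). *)
Lemma form_raise P Q : form (e P) Q = form P (l Q).
Proof.
elim/matq_ind: Q P => [P|c Q Q' IH IH' P|Q a al IH P].
- rewrite l_1 linear0r; elim/matq_ind: P => [|c P P' IH IH'|P a al _].
  + by rewrite e_1 linear0l.
  + by rewrite e_lin linearDl linearZl_LR /= IH IH' mulr0 addr0.
  pose x : X := (a, al); rewrite -/(z x) e_M linearDl /= form_mulz_1 add0r e_z.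
  rewrite (raiseX_linear _ _ _ _ (matq_mull_linear _)) /raiseX /raise.
  case: s => i; case: ifP => _; rewrite ?linear0l // linearZl_LR /=;
    by rewrite (form_mulz_1 _ (_, _)) mulr0.
- by rewrite l_lin !linearDr /= !linearZr_LR /= IH IH'.
pose x : X := (a, al); rewrite -/(z x) form_mulz l_M linearDr.
rewrite (pd_raise q0 hd hpd adj e_lin k_lin e_1 k_1 e_M k_M e_z k_z) linearDl.
congr (_ + _); first exact: etrans (IH _) (esym (form_mulz _ _ _)).
rewrite l_z.
have step y : form (r^-1 *: k (pd y.1 y.2 P)) Q = form P (k Q * (r^-1 *: z y)).
  rewrite linearZl_LR /= k_sym matq_mulZr linearZr_LR /= form_mulz.
  by rewrite fmorphV /= r_real.
rewrite /lowerX /raise; case: s => i; case: ifP => _; 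
  rewrite ?mulr0 ?linear0l ?linear0r //.
  exact: step (_, _).
exact: step (_, _).
Qed.
End Raising.
End FockForm.

(** * Generators of the quantum group *)

Section Generation.

Definition subalgebra (K : fieldType) (X : Type)
    (r : alg_term K X -> alg_term K X -> Prop) (P : palg r -> Prop) : Prop :=
  [/\ P 1, forall c x, P x -> P (c *: x), forall x y, P x -> P y -> P (x + y)
    & forall x y, P x -> P y -> P (x * y)].

Lemma palg_ind (K : fieldType) (X : Type) (r : alg_term K X -> alg_term K X -> Prop)
    (P : palg r -> Prop) :
  subalgebra P -> (forall x, P (palg_gen r x)) -> forall a, P a.
Proof.
move=> [P1 PZ PD PM] Pg a; have [t ->] := palg_ex a.
elim: t => [x|||s Ps t Pt|c t Pt|s Ps t Pt].
- exact: Pg.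
- by have := PZ 0 _ P1; rewrite scale0r.
- exact: P1.
- rewrite -palg_addE; exact: PD.
- rewrite -palg_scaleE; exact: PZ.
- rewrite -palg_mulE; exact: PM.
Qed.

(** [tensor_rel] and [adjoin_rel] take every element of an algebra as a generator
    and force the inclusion to be a morphism.  So a property that is stable
    under the algebra operations needs to be checked only on the generators of
    that algebra. *)
Section Copy.
Variables (K : fieldType) (X Y : Type) (r : alg_term K X -> alg_term K X -> Prop).
Variables (r' : alg_term K Y -> alg_term K Y -> Prop) (c : palg r -> Y).
Hypothesis rc : forall s t, copy_rel (fun a => AGen K (c a)) s t -> r' s t.

Lemma copy_gen1 : palg_gen r' (c 1) = 1.
Proof. exact/palg_piP/acong_rel/rc/(@copy_one _ _ _ r (fun a => AGen K (c a))). Qed.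

Lemma copy_genM x y :
  palg_gen r' (c (x * y)) = palg_gen r' (c x) * palg_gen r' (c y).
Proof.
rewrite [RHS]palg_mulE; apply/palg_piP/acong_rel/rc.
exact: (@copy_mul _ _ _ r (fun a => AGen K (c a)) x y).
Qed.

Lemma copy_subalgebra (P : palg r' -> Prop) :
  subalgebra P -> subalgebra (fun a => P (palg_gen r' (c a))).
Proof.
move=> [P1 PZ PD PM]; split=> [|b x Px|x y Px Py|x y Px Py].
- by rewrite copy_gen1.
- have -> : palg_gen r' (c (b *: x)) = b *: palg_gen r' (c x).
    rewrite [RHS]palg_scaleE; apply/palg_piP/acong_rel/rc.
    exact: (@copy_scale _ _ _ r (fun a => AGen K (c a)) b x).
  exact: PZ.
- have -> : palg_gen r' (c (x + y)) = palg_gen r' (c x) + palg_gen r' (c y).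
    rewrite [RHS]palg_addE; apply/palg_piP/acong_rel/rc.
    exact: (@copy_add _ _ _ r (fun a => AGen K (c a)) x y).
  exact: PD.
by rewrite copy_genM; exact: PM.
Qed.
End Copy.

Variables (K : fieldType) (q : K) (n m : nat).

Let rcA s t : copy_rel (fun a => AGen K (AdjoinElt a)) s t -> @uq_sgl_rel K q n m s t.
Proof. exact: adjoin_copy. Qed.
Let rcl s t : copy_rel (fun a => AGen K (inl a)) s t -> @uq_slsl_rel K q n m s t.
Proof. exact: tensor_left. Qed.
Let rcr s t : copy_rel (fun a => AGen K (inr a)) s t -> @uq_slsl_rel K q n m s t.
Proof. exact: tensor_right. Qed.

Lemma uq_eltE (x : forall k, 'I_k.-1 -> uq_gen k) s : uq_elt q x s =
  palg_gen (@uq_sgl_rel K q n m) (AdjoinElt (palg_gen (@uq_slsl_rel K q n m)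
    (match s with
     | inl i => inl (palg_gen (@uq_rel K q n) (x n i))
     | inr j => inr (palg_gen (@uq_rel K q m) (x m j))
     end))).
Proof.
rewrite /uq_elt; case: s => i; rewrite /tensor.
  by rewrite (copy_gen1 rcr) mulr1.
by rewrite (copy_gen1 rcl) mul1r.
Qed.

(** Three layers of presentations are unfolded: the adjunction of K_0, the
    tensor product and its two factors. *)
Lemma uq_sgl_ind (P : uq_sgl q n m -> Prop) : subalgebra P ->
  (forall s, P (uE q s)) -> (forall s, P (uF q s)) ->
  (forall s, P (uK q s)) -> (forall s, P (uKV q s)) ->
  P (uK0 q n m) -> P (uK0V q n m) -> forall x, P x.
Proof.
move=> sP PE PF PK PKV PK0 PK0V; apply: palg_ind => // -[a||] //.
have sA := copy_subalgebra rcA sP.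
move: a; apply: (palg_ind sA) => -[a|a].
  move: a; apply: (palg_ind (copy_subalgebra rcl sA)) => -[] i.
  - by have := PE (inl i); rewrite /uE uq_eltE.
  - by have := PF (inl i); rewrite /uF uq_eltE.
  - by have := PK (inl i); rewrite /uK uq_eltE.
  - by have := PKV (inl i); rewrite /uKV uq_eltE.
move: a; apply: (palg_ind (copy_subalgebra rcr sA)) => -[] i.
- by have := PE (inr i); rewrite /uE uq_eltE.
- by have := PF (inr i); rewrite /uF uq_eltE.
- by have := PK (inr i); rewrite /uK uq_eltE.
- by have := PKV (inr i); rewrite /uKV uq_eltE.
Qed.

Lemma uq_sl_KKV k i :
  palg_gen (@uq_rel K q k) (UqK i) * palg_gen (@uq_rel K q k) (UqKV i) = 1.
Proof. by rewrite [LHS]palg_mulE; apply/palg_piP/acong_rel; constructor. Qed.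

Lemma uq_sl_KVK k i :
  palg_gen (@uq_rel K q k) (UqKV i) * palg_gen (@uq_rel K q k) (UqK i) = 1.
Proof. by rewrite [LHS]palg_mulE; apply/palg_piP/acong_rel; constructor. Qed.

Lemma uK_uKV s : uK q s * uKV q s = 1 :> uq_sgl q n m.
Proof.
rewrite /uK /uKV !uq_eltE -(copy_genM rcA); case: s => i.
  by rewrite -(copy_genM rcl) uq_sl_KKV (copy_gen1 rcl) (copy_gen1 rcA).
by rewrite -(copy_genM rcr) uq_sl_KKV (copy_gen1 rcr) (copy_gen1 rcA).
Qed.

Lemma uKV_uK s : uKV q s * uK q s = 1 :> uq_sgl q n m.
Proof.
rewrite /uK /uKV !uq_eltE -(copy_genM rcA); case: s => i.
  by rewrite -(copy_genM rcl) uq_sl_KVK (copy_gen1 rcl) (copy_gen1 rcA).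
by rewrite -(copy_genM rcr) uq_sl_KVK (copy_gen1 rcr) (copy_gen1 rcA).
Qed.

Lemma uK0_uK0V : uK0 q n m * uK0V q n m = 1.
Proof. by rewrite [LHS]palg_mulE; apply/palg_piP/acong_rel; constructor. Qed.

Lemma uK0V_uK0 : uK0V q n m * uK0 q n m = 1.
Proof. by rewrite [LHS]palg_mulE; apply/palg_piP/acong_rel; constructor. Qed.

End Generation.

(** * Adjointable elements *)

Section Adjointable.
Variables (C : numClosedFieldType) (q : C) (m n : nat).
Local Notation A := (matq q m n).
Local Notation U := (uq_sgl q n m).
Variables (form : {dot A for (@Num.conj C)}).
Variables (Delta : U -> uq_sgl2 q n m) (eps : U -> C) (act : U -> A -> A).
Hypothesis hact : is_module_algebra Delta eps act.
Variables (star : U -> U) (hstar : is_star star).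

Definition adjointable (xi : U) : Prop :=
  forall P Q, form (act xi P) Q = form P (act (star xi) Q).

Lemma star1 : star 1 = 1.
Proof.
have := star_mul hstar (star 1) 1.
by rewrite mulr1 (star_involutive hstar) mulr1 => <-.
Qed.

Lemma adjointable_subalgebra : subalgebra adjointable.
Proof.
split=> [P Q|c x ax P Q|x y ax ay P Q|x y ax ay P Q].
- by rewrite star1 !(act1 hact).
- rewrite (star_scale hstar) !(linear_atZ (act_linearl hact _)).
  by rewrite linearZl_LR linearZr_LR /= conjCK ax.
- rewrite (star_add hstar) !(linear_atD (act_linearl hact _)).
  by rewrite linearDl linearDr /= ax ay.
by rewrite (star_mul hstar) !(actM hact) ax ay.
Qed.

(** The form is Hermitian and star is an involution. *)
Lemma adjointable_star x : adjointable x -> adjointable (star x).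
Proof.
move=> ax P Q; rewrite (star_involutive hstar) form_hermitian -ax.
by rewrite -form_hermitian.
Qed.

(** If x is invertible then so is star x, with inverse star y; hence
    (y P, Q) = (y P, star x (star y Q)) = (x (y P), star y Q). *)
Lemma adjointable_inv x y :
  x * y = 1 -> y * x = 1 -> adjointable x -> adjointable y.
Proof.
move=> xy yx ax P Q.
have {1}-> : Q = act (star x) (act (star y) Q).
  by rewrite -(actM hact) -(star_mul hstar) yx star1 (act1 hact).
by rewrite -ax -(actM hact) xy (act1 hact).
Qed.

End Adjointable.

(** * Invariance on the generators *)

Section Main.
Variables (C : numClosedFieldType) (q r : C) (m n : nat).
Hypotheses (q0 : q != 0) (q_real : Num.conj q = q).
Hypotheses (r_real : Num.conj r = r) (rr : r * r = q).
Local Notation A := (matq q m n).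
Local Notation U := (uq_sgl q n m).
Local Notation X := ('I_n * 'I_m)%type.
Variables (d : A -> omega1 q m n) (pd : 'I_n -> 'I_m -> A -> A).
Hypotheses (hd : is_differential d) (hpd : are_partials d pd).
Variables (form : {dot A for (@Num.conj C)}) (hform : is_fock_form pd form).
Variables (Delta : U -> uq_sgl2 q n m) (S : U -> U) (eps : U -> C).
Hypothesis hhopf : is_hopf Delta S eps.
Variable act : U -> A -> A.
Hypotheses (hact : is_module_algebra Delta eps act).
Hypotheses (hgen : acts_on_generators r act).
Variables (star : U -> U) (hstar : is_star star).
Let z (x : X) : A := matq_z q x.1 x.2.

Lemma act_grouplike_mul xi : Delta xi = xi ⊗ xi ->
  forall f g, act xi (f * g) = act xi f * act xi g.
Proof.
move=> D f g; rewrite (act_mul hact (s := [:: (xi, xi)])) ?big_seq1 //.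
Qed.

Lemma act_grouplike1 xi : eps xi = 1 -> act xi 1 = 1.
Proof. by move=> e; rewrite (act_unit hact) e scale1r. Qed.

Lemma adjointable_K0 : adjointable form act star (uK0 q n m).
Proof.
move=> P Q; rewrite (star_K0 hstar).
apply: (form_diag q0 hd hpd hform (k1 := fun=> q ^+ (n + m)) (k2 := fun=> 1)).
- exact: act_linear hact _.
- exact/act_grouplike1/(hopf_epsK0 hhopf).
- exact/act_grouplike_mul/(hopf_DeltaK0 hhopf).
- by move=> x; rewrite (act_K0 hgen) mulr1.
- by move=> x; rewrite mulr1 rmorphXn /= q_real.
Qed.

Fact simple_root_bounds k (i : 'I_k.-1) :
  (i < k)%N * (i.+1 < k)%N * (k - i.+2 < k)%N * (k - i.+1 < k)%N.
Proof. by case: i => i /= lti; do !split; lia. Qed.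

(** The indices, counted from 0, between which the generators with index s move:
    i and i + 1 on the Latin side, and m - j - 1 and m - j for the Greek side
    with j counted from 1. *)
Definition root_step (s : 'I_n.-1 + 'I_m.-1) : 'I_n * 'I_n + 'I_m * 'I_m :=
  match s with
  | inl i => let p := simple_root_bounds i in inl (Ordinal p.1.1.1, Ordinal p.1.1.2)
  | inr j => let p := simple_root_bounds j in inr (Ordinal p.1.2, Ordinal p.2)
  end.

Lemma root_step_adjacent s : adjacent (root_step s).
Proof. by case: s => [i|[i lti]] //=; lia. Qed.

Lemma act_uK s x : act (uK q s) (z x) = weightX q (root_step s) x *: z x.
Proof.
case: s x => [i|j] [a al]; rewrite /weightX /weight /= -!val_eqE /=.
  by rewrite (act_Kl hgen).
have e : (m - j.+1)%N = (m - j.+2).+1 by case: j => j /= ltj; lia.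
by rewrite (act_Kr hgen) eqSS {1}e eqSS.
Qed.

Lemma act_uE s x : act (uE q s) (z x) = raiseX r (root_step s) z x.
Proof.
case: s x => [i|j] [a al]; rewrite /raiseX /raise /z /=; case: eqP => [->|ne].
- exact: (act_El hgen).
- by apply: (act_El0 hgen) => -[e]; case: ne; apply: val_inj.
- apply: (act_Er hgen) => //=; case: j => j /= ltj; lia.
- by apply: (act_Er0 hgen) => -[e]; case: ne; apply: val_inj.
Qed.

Lemma act_uF s x : act (uF q s) (z x) = lowerX r^-1 (root_step s) z x.
Proof.
case: s x => [i|j] [a al]; rewrite /lowerX /raise /z /= invrK; case: eqP => [->|ne].
- exact: (act_Fl hgen).
- by apply: (act_Fl0 hgen) => -[e]; case: ne; apply: val_inj.
- apply: (act_Fr hgen) => //=; case: j => j /= ltj; lia.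
- apply: (act_Fr0 hgen) => e; case: ne; apply: val_inj => /=.
  by case: j e => j /= ltj; lia.
Qed.

(** F has the coefficient r, and K multiplies it by q^-1 = r^-2. *)
Lemma act_uKF s x : act (uK q s * uF q s) (z x) = lowerX r (root_step s) z x.
Proof.
have r0 : r != 0 by apply: contraNneq q0 => r0; rewrite -rr r0 mul0r.
have wz k (W : lmodType C) (i0 i1 : 'I_k) (g : 'I_k -> W) : i1 = i0.+1 :> nat ->
    r^-1^-1 *: (weight q i0 i1 i1 *: g i1) = r^-1 *: g i1.
  move=> i01; rewrite /weight eqxx -val_eqE /= i01 gtn_eqF // scalerA invrK.
  by rewrite -rr invfM mulrA divff // mul1r.
rewrite (actM hact) act_uF; have := root_step_adjacent s; have := act_uK s.
rewrite /lowerX /raise; case: (root_step s) => i /= Kz adj; case: ifP => _.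
- rewrite (linear_atZ (act_linear hact _)) Kz /=.
  by rewrite (wz _ _ _ _ (fun a => z (a, x.2))).
- exact: linear_at0 (act_linear hact _).
- rewrite (linear_atZ (act_linear hact _)) Kz /=.
  by rewrite (wz _ _ _ _ (fun al => z (x.1, al))).
exact: linear_at0 (act_linear hact _).
Qed.

Lemma adjointable_uK s : adjointable form act star (uK q s).
Proof.
move=> P Q; rewrite (star_K hstar).
apply: (form_diag q0 hd hpd hform (k1 := weight_fst q (root_step s))
  (k2 := weight_snd q (root_step s))).
- exact: act_linear hact _.
- exact/act_grouplike1/(hopf_epsK hhopf).
- exact/act_grouplike_mul/(hopf_DeltaK hhopf).
- by move=> x; rewrite -weightXE act_uK.
move=> x; rewrite -weightXE /weightX /weight; case: (root_step s) => i;
  by do ?[case: ifP => _]; rewrite ?rmorph1 ?fmorphV /= ?q_real.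
Qed.

Lemma adjointable_uE s : adjointable form act star (uE q s).
Proof.
move=> P Q; rewrite (star_E hstar).
have K_lin := act_linear hact (uK q s).
apply: (form_raise q0 r_real hd hpd hform (root_step_adjacent s)
  (e := act (uE q s)) (k := act (uK q s)) (l := act (uK q s * uF q s))).
- exact: act_linear hact _.
- exact: K_lin.
- exact: act_linear hact _.
- by rewrite (act_unit hact) (hopf_epsE hhopf) scale0r.
- exact/act_grouplike1/(hopf_epsK hhopf).
- rewrite (actM hact) (act_unit hact) (hopf_epsF hhopf) scale0r.
  exact: linear_at0 K_lin.
- move=> f g; rewrite (act_mul hact (s := [:: (uE q s, 1); (uK q s, uE q s)])).
    by rewrite big_cons big_seq1 /= (act1 hact).
  by rewrite big_cons big_seq1 (hopf_DeltaE hhopf).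
- exact/act_grouplike_mul/(hopf_DeltaK hhopf).
- move=> f g; rewrite (actM hact).
  rewrite (act_mul hact (s := [:: (uF q s, uKV q s); (1, uF q s)])); last first.
    by rewrite big_cons big_seq1 (hopf_DeltaF hhopf).
  rewrite big_cons big_seq1 /= (act1 hact) (linear_atD K_lin).
  rewrite !(act_grouplike_mul (hopf_DeltaK hhopf _)) -!(actM hact).
  by rewrite uK_uKV (act1 hact).
- exact: act_uE.
- exact: act_uK.
- exact: act_uKF.
by move=> P' Q'; rewrite adjointable_uK (star_K hstar).
Qed.

(** F_s = K_s^-1 (K_s F_s), and K_s F_s = E_s^* is adjointable because E_s is. *)
Lemma all_adjointable xi : adjointable form act star xi.
Proof.
have aKV s : adjointable form act star (uKV q s).
  apply: (adjointable_inv hact hstar (x := uK q s)).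
  - exact: uK_uKV.
  - exact: uKV_uK.
  exact: adjointable_uK.
have sub := adjointable_subalgebra form hact hstar; have [_ _ _ aM] := sub.
move: xi; apply: (uq_sgl_ind sub) => [s|s|s|s||].
- exact: adjointable_uE.
- have -> : uF q s = uKV q s * (uK q s * uF q s) by rewrite mulrA uKV_uK mul1r.
  apply: aM; first exact: aKV.
  rewrite -(star_E hstar).
  exact/(adjointable_star hstar)/adjointable_uE.
- exact: adjointable_uK.
- exact: aKV.
- exact: adjointable_K0.
- apply: (adjointable_inv hact hstar (x := uK0 q n m)).
  + exact: uK0_uK0V.
  + exact: uK0V_uK0.
  exact: adjointable_K0.
Qed.

End Main.

Unset Implicit Arguments.

Theorem theorem2p2 (R : realType) (q : R) (hq0 : 0 < q) (hq1 : q < 1)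
    (m n : nat)
    (d : matq q%:C m n -> omega1 q%:C m n) (hd : is_differential d)
    (pd : 'I_n -> 'I_m -> matq q%:C m n -> matq q%:C m n)
    (hpd : are_partials d pd)
    (form : {dot (matq q%:C m n) for (@Num.conj R[i])})
    (hform : is_fock_form pd form)
    (Delta : uq_sgl q%:C n m -> uq_sgl2 q%:C n m)
    (S : uq_sgl q%:C n m -> uq_sgl q%:C n m)
    (eps : uq_sgl q%:C n m -> R[i])
    (hhopf : is_hopf Delta S eps)
    (act : uq_sgl q%:C n m -> matq q%:C m n -> matq q%:C m n)
    (hact : is_module_algebra Delta eps act)
    (hgen : acts_on_generators (Num.sqrt q)%:C act)
    (star : uq_sgl q%:C n m -> uq_sgl q%:C n m) (hstar : is_star star)
    (P Q : matq q%:C m n) (xi : uq_sgl q%:C n m) :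
  form (act xi P) Q = form P (act (star xi) Q).
Proof.
have conj_real (x : R) : Num.conj x%:C = x%:C.
  by apply: conj_Creal; rewrite complex_real.
apply: (all_adjointable (r := (Num.sqrt q)%:C) _ _ _ _
  hd hpd hform hhopf hact hgen hstar).
- by rewrite fmorph_eq0 gt_eqF.
- exact: conj_real.
- exact: conj_real.
by rewrite -rmorphM /= -expr2 sqr_sqrtr // ltW.
Qed.
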